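(* Let $\mathcal{B}$ be a rare basis in $\mathbb{R}^n$. If there exist infinite sets $S_1,\dots,S_n\subset\mathbb{Z}$ for which the spectrum $W_{\mathcal{B}}$ of $\mathcal{B}$ is dense in $S_1\times\dots\times S_n$, then the maximal operator $M_{\mathcal{B}}$ satisfies a sharp weak type $L(1+\log^+L)^{n-1}$ estimate. Moreover, for every $\alpha\in(0,1)$ there exists a bounded set $E_\alpha\subset\mathbb{R}^n$ with positive measure such that $$|\{x\in\mathbb{R}^n: M_{\mathcal{B}}(\chi_{E_\alpha})(x)>\alpha\}|\ \geq\ c_n\,\frac{1}{\alpha}\Big(1+\log\frac1\alpha\Big)^{n-1}|E_\alpha|,$$ where $c_n>0$ is a constant depending only on $n$.
   Context: An interval in $\mathbb{R}^n$ is a rectangular parallelepiped (of positive finite measure) $R=R_1\times\dots\times R_n$ with sides parallel to the coordinate axes, where the $R_i$ are one-dimensional intervals. A rare basis in $\mathbb{R}^n$ is a nonempty translation invariant collection $\mathcal{B}$ of intervals in $\mathbb{R}^n$. $|\cdot|$ denotes Lebesgue measure (length for one-dimensional intervals), $\log=\log_2$, $\log^+u=\max(\log u,0)$ with $\log^+0=0$, and $\chi_E$ is the indicator function of $E$. The associated maximal operator is $$M_{\mathcal{B}}f(x)=\sup_{x\in R\in\mathcal{B}}\frac1{|R|}\int_R|f|$$ for measurable $f$ on $\mathbb{R}^n$. ''$M_{\mathcal{B}}$ satisfies a sharp weak type $L(1+\log^+L)^{n-1}$ estimate'' means: (i) there is a finite constant $C$ such that $|\{x: M_{\mathcal{B}}f(x)>\alpha\}|\le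 C\int_{\mathbb{R}^n}\frac{|f|}{\alpha}\big(1+\log^+\frac{|f|}{\alpha}\big)^{n-1}$ for all measurable $f$ and all $\alpha>0$; and (ii) if $\phi:[0,\infty)\to[0,\infty)$ is a convex increasing function with $\phi(0)=0$ and $\lim_{u\to\infty}\frac{\phi(u)}{u(1+\log u)^{n-1}}=0$, then there is no finite constant $C$ such that $|\{x: M_{\mathcal{B}}f(x)>\alpha\}|\le C\int_{\mathbb{R}^n}\phi\big(\frac{|f|}{\alpha}\big)$ for all measurable $f$ and all $\alpha>0$. The spectrum of $\mathcal{B}$ is the set $W_{\mathcal{B}}\subset\mathbb{Z}^n$ of all $n$-tuples $(\lceil\log|R_1|\rceil,\dots,\lceil\log|R_n|\rceil)$ with $R_1\times\dots\times R_n\in\mathcal{B}$, where $\lceil x\rceil$ is the least integer $\ge x$. A set $W\subset\mathbb{Z}$ is a net for a set $S\subset\mathbb{Z}$ if there is $N\in\mathbb{N}$ such that for every $s\in S$ there is $w\in W$ with $|s-w|\le N$. For $k\ge2$, $W\subset\mathbb{Z}^k$ and $t\in\mathbb{Z}^{k-1}$, put $W_t=\{\tau\in\mathbb{Z}:(t,\tau)\in W\}$; a set $W\subset\mathbb{Z}^k$ is a net for $S\subset\mathbb{Z}^k$ if $W_t$ is a net for $S_t$ for every $t\in\mathbb{Z}^{k-1}$ (the number $N$ may depend on $t$). For $1\le k\le n$ let $\pi_k:\mathbb{R}^n\to\mathbb{R}^k$, $\pi_k(x_1,\dots,x_n)=(x_1,\dots,x_k)$. For $S_1,\dots,S_n\subset\mathbb{Z}$,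 a set $W\subset\mathbb{Z}^n$ is dense in $S_1\times\dots\times S_n$ if the sets $\pi_1(W),\pi_2(W),\dots,\pi_n(W)=W$ are nets for the sets $S_1,\ \pi_1(W)\times S_2,\ \dots,\ \pi_{n-1}(W)\times S_n$, respectively. *)

(* Defs.v *)
From HB Require Import structures.
From mathcomp Require Import all_boot all_order all_algebra.
From mathcomp Require Import all_classical all_reals all_analysis.

Set Implicit Arguments.
Unset Strict Implicit.
Unset Printing Implicit Defensive.

Import Order.TTheory GRing.Theory Num.Theory.
Import numFieldNormedType.Exports.

Local Open Scope classical_set_scope.
Local Open Scope ring_scope.

Section lebesgue_measure_step.
Context (R : realType) (n : nat).
Variable mu : {sigma_finite_measure set (n.-tuple (measurableTypeR R)) -> \bar R}.

Definition cons_pair (p : measurableTypeR R * n.-tuple (measurableTypeR R)) :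
  n.+1.-tuple (measurableTypeR R) := [the n.+1.-tuple _ of p.1 :: p.2].

Lemma measurable_cons_pair : measurable_fun [set: _] cons_pair.
Proof. by apply: measurable_cons. Qed.

Definition cons_measure : set (n.+1.-tuple (measurableTypeR R)) -> \bar R :=
  pushforward (lebesgue_measure \x mu)%E cons_pair.

Let cons_measure0 : cons_measure set0 = 0%E.
Proof. by rewrite /cons_measure /pushforward preimage_set0 measure0. Qed.

Let cons_measure_ge0 A : (0 <= cons_measure A)%E.
Proof. by rewrite /cons_measure /pushforward; exact: measure_ge0. Qed.

Let cons_measure_sigma_additive : semi_sigma_additive cons_measure.
Proof.
move=> F mF tF mUF; rewrite /cons_measure /pushforward preimage_bigcup.
have mpre A : measurable A -> measurable (cons_pair @^-1` A).
  by move=> mA; rewrite -[X in measurable X]setTI; exact: measurable_cons_pair.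
apply: measure_semi_sigma_additive.
- by move=> k; exact: mpre.
- apply/trivIsetP => /= i j _ _ ij; rewrite -preimage_setI.
  by move/trivIsetP : tF => /(_ _ _ _ _ ij) -> //; rewrite preimage_set0.
- by rewrite -preimage_bigcup; exact: mpre.
Qed.

HB.instance Definition _ := isMeasure.Build _ _ _ cons_measure
  cons_measure0 cons_measure_ge0 cons_measure_sigma_additive.

Lemma cons_measure_sigma_finite : sigma_finite setT cons_measure.
Proof.
(* [sigma_finiteT] does not apply: the instance found on [\x] is the one for
   subprobabilities *)
have [F FT Foo] : sigma_finite setT (lebesgue_measure \x mu)%E.
  have /sigma_finiteP[F [TF ndF Foo]] := sigma_finiteT (@lebesgue_measure R).
  have /sigma_finiteP[G [TG ndG Goo]] := sigma_finiteT mu.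
  exists (fun k => F k `*` G k).
    rewrite -setXTT TF TG predeqE => -[x y]; split.
      move=> [/= [k _ Fkx] [l _ Gly]]; exists (maxn k l) => //; split.
      - by move: x Fkx; exact/subsetPset/ndF/leq_maxl.
      - by move: y Gly; exact/subsetPset/ndG/leq_maxr.
    by move=> [k _ []/= ? ?]; split; exists k.
  move=> k; have [? ?] := Foo k; have [? ?] := Goo k.
  split; first exact: measurableX.
  by rewrite product_measure1E// lte_mul_pinfty// ge0_fin_numE.
pose uncons (x : n.+1.-tuple (measurableTypeR R)) :
  measurableTypeR R * n.-tuple (measurableTypeR R) :=
  (tnth x ord0, [tuple of behead x]).
have muncons : measurable_fun setT uncons.
  apply/measurable_fun_pairP; split; first exact: measurable_tnth.
  exact: measurable_behead.
have unconsK p : uncons (cons_pair p) = p.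
  by case: p => a t; rewrite /uncons; congr pair; apply/val_inj.
exists (fun i => uncons @^-1` F i); first by rewrite -preimage_bigcup -FT.
move=> i; have [mF F_oo] := Foo i; split.
  by rewrite -[X in measurable X]setTI; exact: muncons.
rewrite /cons_measure /pushforward -comp_preimage (_ : uncons \o _ = id) //.
by apply/funext => p /=; rewrite unconsK.
Qed.

HB.instance Definition _ := Measure_isSigmaFinite.Build _ _ _ cons_measure
  cons_measure_sigma_finite.

End lebesgue_measure_step.

(* n-fold product of the one-dimensional Lebesgue measure, on Borel sets *)
Fixpoint borel_volume (R : realType) (n : nat) :
    {sigma_finite_measure set (n.-tuple (measurableTypeR R)) -> \bar R} :=
  match n with
  | 0 => [the {sigma_finite_measure set (0.-tuple (measurableTypeR R)) -> \bar R}
            of dirac [tuple]]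
  | m.+1 => [the {sigma_finite_measure set (m.+1.-tuple (measurableTypeR R)) -> \bar R}
            of cons_measure (borel_volume R m)]
  end.

(* R^n equipped with the sigma-algebra of Lebesgue-measurable sets: [measurable]
   at this type means Lebesgue measurable, not only Borel. *)
Definition euclidean (R : realType) (n : nat) :=
  caratheodory_type (borel_volume R n)^*%mu.
HB.instance Definition _ (R : realType) (n : nat) :=
  Measurable.on (euclidean R n).

Definition volume (R : realType) (n : nat) : set (euclidean R n) -> \bar R :=
  @completed_measure_extension _ _ _ (borel_volume R n).
HB.instance Definition _ (R : realType) (n : nat) := Measure.on (@volume R n).

Section rare_bases.
Context (R : realType) (n : nat).
Implicit Types (A E : set (euclidean R n)) (I : 'I_n -> set R).
Implicit Types (B : set (set (euclidean R n))) (f : euclidean R n -> R).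

Definition component (x : euclidean R n) (i : 'I_n) : R :=
  tnth (x : n.-tuple R) i.

Definition box I : set (euclidean R n) := [set x | forall i, I i (component x i)].

(* The sides may be open, closed or half-open. *)
Definition interval_box I :=
  (forall i, is_interval (I i)) /\ (0 < volume (box I) < +oo)%E.

Definition translate (v : euclidean R n) A : set (euclidean R n) :=
  [set [tuple component x i + component v i | i < n] | x in A].

Definition rare_basis B :=
  [/\ B !=set0,
      (forall A, B A -> exists2 I, interval_box I & A = box I) &
      (forall v A, B A -> B (translate v A))].

Definition maximal_operator B f (x : euclidean R n) : \bar R :=
  ereal_sup [set ((fine (volume A))^-1%:E *
                  \int[@volume R n]_(y in A) `|f y|%:E)%E | A in [set A | B A /\ A x]].

Definition log2 (u : R) : R := ln u / ln 2.

(* [ln 0 = 0], hence [log2p 0 = 0] *)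
Definition log2p (u : R) : R := Num.max (log2 u) 0.

Definition weak_type B (Phi : R -> R) (C : R) :=
  forall f, measurable_fun setT f -> forall alpha : R, 0 < alpha ->
    (volume [set x | alpha%:E < maximal_operator B f x] <=
     C%:E * \int[@volume R n]_x (Phi (`|f x| / alpha))%:E)%E.

(* Only the values of [phi] on [0, +oo[ are constrained. *)
Definition convex_increasing (phi : R -> R) :=
  [/\ (forall u, 0 <= u -> 0 <= phi u),
      convex_function (`[0, +oo[%classic : set R) phi,
      {in `[0, +oo[ &, {homo phi : u v / u <= v}} &
      phi 0 = 0].

Definition sharp_weak_type B :=
  (exists C : R, weak_type B (fun u => u * (1 + log2p u) ^+ n.-1) C) /\
  (forall phi : R -> R, convex_increasing phi ->
     phi u / (u * (1 + log2 u) ^+ n.-1) @[u --> +oo] --> (0 : R) ->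
     ~ exists C : R, weak_type B phi C).

Definition spectrum B : set (n.-tuple int) :=
  [set w | exists I, [/\ interval_box I, B (box I) &
     forall i, tnth w i = Num.ceil (log2 (fine (lebesgue_measure (I i))))]].

Definition bounded_subset E :=
  exists M : R, forall x, E x -> forall i, `|component x i| <= M.

End rare_bases.

Definition int_net (W S : set int) :=
  exists N : nat, forall s, S s -> exists2 w, W w & `|s - w| <= N%:Z.

Definition slice (k : nat) (W : set (k.+1.-tuple int)) (t : k.-tuple int) :
    set int :=
  [set tau | W [tuple of rcons t tau]].

(* For [k = 0] the only [t] is the empty tuple, and this is [int_net] under the
   identification of Z^1 with Z. *)
Definition net (k : nat) (W S : set (k.+1.-tuple int)) :=
  forall t : k.-tuple int, int_net (slice W t) (slice S t).

(* First [k] coordinates; only used for [k <= n], so that the default value 0 of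
   [nth] is never reached. *)
Definition prefix_proj (n k : nat) (x : n.-tuple int) : k.-tuple int :=
  [tuple nth 0 x i | i < k].

(* The target set for the [k]-th projection (0-based) is
   [prefix_proj k @` W] x S_k, which for [k = 0] reads S_0. *)
Definition dense_in (n : nat) (W : set (n.-tuple int)) (S : 'I_n -> set int) :=
  forall k : 'I_n,
    net (prefix_proj k.+1 @` W)
        [set t | ((0 < k)%N -> (prefix_proj k @` W) (prefix_proj k t)) /\ S k (tnth t ord_max)].

(* Main.v *)
Require Import Defs.
From HB Require Import structures.
From mathcomp Require Import all_boot all_order all_algebra.
From mathcomp Require Import all_classical all_reals all_analysis.
From mathcomp Require Import measurable_realfun zify ring lra.

Set Implicit Arguments.
Unset Strict Implicit.
Unset Printing Implicit Defensive.

Import Order.TTheory GRing.Theory Num.Theory.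
Import numFieldNormedType.Exports.

Local Open Scope classical_set_scope.
Local Open Scope ring_scope.

(** The weak type estimate holds for every family of intervals. An interval lies
    in a product of open intervals with rational centres and radii, of volume at
    most [2 ^ n] times its own. Hence [maximal_operator B f] is at most [2 ^ n]
    times the function obtained by applying the one-dimensional maximal operator
    over rational intervals once in each coordinate ([maximal_operator_le]). In
    dimension one, Vitali covering gives the weak (1,1) inequality, and truncating
    [g] at height [a] turns it into
    [|{M g > 2 a}| <= sum_j 6 * 2 ^ j * |{g > 2 ^ j * a}|]
    ([rat_maximal_layer]). This form composes: by Fubini, the level sets of the
    maximal function in [n] coordinates are fed into the inequality for one more
    coordinate ([iter_maximal_weak]). At a point where [u = |f| / a], only the
    heights [2 ^ j < u] contribute. The first coordinate produces
    [sum_j 2 ^ j <= 2 u], and every further one contributes the number of these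
    heights, which is at most [1 + log2 u] ([layer_gauge_le]).

    For the lower bound, the set [E] is a product of Cantor-like sets. On the
    line there are nested sets [F_0, F_1, ..., F_k] with [|F_a| = 2 ^ a |F_0|]
    such that every point of [F_a] lies in an interval of length [L] in which
    [F_0] has density at least [2 ^ - a / 2]; here [L] is any length in a window
    attached to [a], and the windows can be prescribed as long as they are ordered
    and far apart ([nested_towers]). Density of the spectrum in a product of
    infinite sets is what allows windows to be chosen, coordinate by coordinate,
    so that every choice of one window per coordinate contains the side lengths of
    some interval of [B]: the constants [N] of the nets that occur are finitely
    many at each step, and the infinite set [S_i] has points separated by more
    than these constants ([dense_in_tree]). If [a_1 + ... + a_n = k], the maximal
    function of the indicator of [E] is then at least [2 ^ - (k + n)] on the
    product of the sets [F_(a_i)]. There are about [k ^ (n - 1)] such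
    [n]-tuples, and replacing [F_a] by [F_a] minus [F_(a - 1)] in all coordinates
    but one makes the products disjoint while each keeps a volume of at least
    [2 ^ (k - n + 1) |E|]. This yields the bound
    [2 ^ k * k ^ (n - 1) * |E|], up to a factor depending on [n] only
    ([lower_bound_dyadic]), for [alpha] comparable to [2 ^ - k].

    Sharpness follows from the lower bound: a weak type inequality with gauge
    [phi], applied to the indicator of [E] with [alpha = 1 / u], forces [phi u] to be
    at least a constant times [u * (1 + log2 u) ^ (n - 1)] ([not_weak_type]). *)

(** * One-dimensional maximal inequality *)

Section hardy_littlewood_rational.
Context (R : realType).
Local Notation leb := (@lebesgue_measure R).
Implicit Types (g : measurableTypeR R -> \bar R) (m : nat).

(** Rational intervals are enumerated by [nat], so that the suprema below are
    countable and hence Borel; the default radius [1] keeps every index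
    nondegenerate. *)
Definition rat_center m : R :=
  if (unpickle m : option (rat * rat)) is Some q then ratr q.1 else 0.
Definition rat_radius m : R :=
  if (unpickle m : option (rat * rat)) is Some q then
    if (0 < q.2) then ratr q.2 else 1 else 1.
Definition rat_ball m : set R := ball (rat_center m) (rat_radius m).

Lemma rat_radius_gt0 m : 0 < rat_radius m.
Proof.
rewrite /rat_radius; case: unpickle => // q; case: ifPn => // q0.
by rewrite ltr0q.
Qed.

Lemma measurable_rat_ball m : measurable (rat_ball m : set (measurableTypeR R)).
Proof. by rewrite /rat_ball ball_itv; exact: measurable_itv. Qed.

Lemma rat_ballE m x : rat_ball m x = (`|rat_center m - x| < rat_radius m).
Proof. by []. Qed.

(** The covering ball has length [2 * rat_radius m <= 2 * L]: passing from an
    interval to a rational one costs a factor [2] per coordinate. *)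
Lemma rat_ball_cover (e L : R) : 0 < L ->
  exists m, `[e, e + L] `<=` rat_ball m /\ rat_radius m <= L.
Proof.
move=> L0.
have [c /= /itvP c_in] : exists c : rat,
    ratr c \in `](e + L / 2 - L / 8), (e + L / 2 + L / 8)[.
  have /rat_in_itvoo[c hc] : e + L / 2 - L / 8 < e + L / 2 + L / 8 by lra.
  by exists c.
have [r /= /itvP r_in] : exists r : rat, ratr r \in `](5 * L / 8), L[.
  have /rat_in_itvoo[c' hc] : 5 * L / 8 < L by lra.
  by exists c'.
have cl : e + L / 2 - L / 8 < ratr c by rewrite c_in.
have cr : ratr c < e + L / 2 + L / 8 by rewrite c_in.
have rl : 5 * L / 8 < ratr r by rewrite r_in.
have rr : ratr r < L by rewrite r_in.
have r0 : 0 < r by rewrite -(ltr0q R); lra.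
exists (pickle (c, r)); split; last first.
  by rewrite /rat_radius pickleK /= r0 ltW.
move=> x /=; rewrite in_itv /= => /andP[ex xe].
rewrite rat_ballE /rat_center /rat_radius pickleK /= r0.
rewrite ltr_norml; lra.
Qed.

Definition ball_average g m : \bar R :=
  ((2 * rat_radius m)^-1%:E * \int[leb]_(y in rat_ball m) g y)%E.

Definition rat_maximal g (x : R) : \bar R :=
  ereal_sup [set ball_average g m | m in [set m | rat_ball m x]].

Lemma rat_maximal_gt g (a : \bar R) x :
  (a < rat_maximal g x)%E <-> exists2 m, rat_ball m x & (a < ball_average g m)%E.
Proof.
split; first by move=> /ereal_sup_gt[_ /= [m mx <-] am]; exists m.
move=> [m mx am]; apply: (lt_le_trans am); apply: ereal_sup_ubound => /=.
by exists m.
Qed.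

Lemma rat_maximal_level g (a : \bar R) :
  [set x | (a < rat_maximal g x)%E] =
  \bigcup_(m in [set m | (a < ball_average g m)%E]) rat_ball m.
Proof.
by apply/seteqP; split => x /=; rewrite rat_maximal_gt => -[m]; exists m.
Qed.

Lemma le_ball_average g1 g2 m :
  measurable_fun [set: measurableTypeR R] g1 -> measurable_fun setT g2 ->
  (forall x, 0 <= g1 x)%E -> (forall x, g1 x <= g2 x)%E ->
  (ball_average g1 m <= ball_average g2 m)%E.
Proof.
move=> m1 m2 g0 g12; apply: lee_wpmul2l.
  by rewrite lee_fin invr_ge0 mulr_ge0// ltW// rat_radius_gt0.
by apply: (ge0_le_integral _ (measurable_rat_ball m)) => //; exact: measurable_funTS.
Qed.

(** By continuity from below it is enough to bound finite unions of balls on which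
    the average exceeds [a]; Vitali's lemma extracts disjoint balls whose triples
    cover the union. *)
Lemma rat_maximal_weak11 g (a : R) : measurable_fun [set: measurableTypeR R] g ->
  (forall x, 0 <= g x)%E -> 0 < a ->
  (leb [set x | a%:E < rat_maximal g x] <= (3 / a)%:E * \int[leb]_x g x)%E.
Proof.
move=> mg g0 a0; rewrite rat_maximal_level.
pose A m := if m \in [set m | (a%:E < ball_average g m)%E] then rat_ball m else set0.
have mA m : measurable (A m : set (measurableTypeR R)).
  by rewrite /A; case: ifP => // _; exact: measurable_rat_ball.
rewrite bigcup_mkcond -(bigcup_bigsetU_bigcup A).
have mAn n : measurable (\big[setU/set0]_(i < n.+1) A i : set (measurableTypeR R)).
  exact: bigsetU_measurable.
have ndA : nondecreasing_seq (fun n => \big[setU/set0]_(i < n.+1) A i).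
  by move=> p q pq; apply/subsetPset; apply: subset_bigsetU.
have mU : measurable (\bigcup_n \big[setU/set0]_(i < n.+1) A i : set (measurableTypeR R)).
  exact: bigcupT_measurable.
have cv := nondecreasing_cvg_mu (mu := leb) mAn mU ndA.
apply: (@le_trans _ _ (limn (leb \o (fun n => \big[setU/set0]_(i < n.+1) A i)))).
  by rewrite (cvg_lim _ cv).
apply: lime_le; first by apply/cvg_ex; eexists; exact: cv.
apply: nearW => n /=.
pose s := [seq m <- iota 0 n.+1 | (a%:E < ball_average g m)%E].
have is_ballB i : is_ball (rat_ball i) by exact: is_ball_ball.
have Bset0 i : rat_ball i !=set0.
  by exists (rat_center i); apply: ballxx; exact: rat_radius_gt0.
have [E [uE Es tEB DE]] := vitali_lemma_finite_cover is_ballB Bset0 s.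
have sub : \big[setU/set0]_(i < n.+1) A i `<=`
    cover [set` E] ((scale_ball 3%:R) \o rat_ball).
  apply: subset_trans DE; rewrite -bigcup_mkord => x [m /= mn].
  rewrite /A; case: ifPn => // /set_mem /= am mx; exists m => //=.
  by rewrite mem_filter am mem_iota /=.
apply: (@le_trans _ _ (3%:E * \sum_(i <- E) leb (rat_ball i)))%E.
  apply: (le_trans (@content_subadditive _ _ _ leb (\big[setU/set0]_(i < n.+1) A i)
      (fun i => 3 *` rat_ball (nth 0%N E i)) (size E) _ _ _)) => //.
  - by move=> k ?; rewrite scale_ballE//; exact: measurable_ball.
  - apply: (subset_trans sub); rewrite /cover bigcup_seq.
    by rewrite (big_nth 0%N)//= big_mkord.
  - rewrite ge0_sume_distrr//= (big_nth 0%N) big_mkord; apply: lee_sum => i _.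
    have r0 := ltW (rat_radius_gt0 (nth 0%N E i)).
    rewrite scale_ballE// !lebesgue_measure_ball ?mulr_ge0 //.
    by rewrite -mulrnAr EFinM.
rewrite EFinM -muleA lee_wpmul2l//=.
apply: (@le_trans _ _ (\sum_(i <- E) a^-1%:E * \int[leb]_(y in rat_ball i) g y))%E.
  rewrite [in leLHS]big_seq [in leRHS]big_seq; apply: lee_sum => r /Es.
  rewrite mem_filter => /andP[+ _].
  rewrite /ball_average => /ltW; have r0 := rat_radius_gt0 r.
  rewrite lee_pdivlMl ?mulr_gt0// => H.
  rewrite -lee_pdivrMl ?invr_gt0// invrK lebesgue_measure_ball ?(ltW r0)//.
  apply: (le_trans _ H); rewrite -!EFinM lee_fin le_eqVlt.
  by apply/orP; left; apply/eqP; ring.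
rewrite -ge0_sume_distrr; last by move=> x _; rewrite integral_ge0.
rewrite lee_wpmul2l//; first by rewrite lee_fin invr_ge0 ltW.
rewrite -ge0_integral_bigsetU//=.
- apply/ge0_subset_integral => //.
  by apply/bigsetU_measurable => ? ?; exact: measurable_rat_ball.
- by move=> i; exact: measurable_rat_ball.
- exact: measurable_funTS.
Qed.

End hardy_littlewood_rational.

Section layers.
Context (R : realType).
Local Notation leb := (@lebesgue_measure R).

Lemma nneseries_ge_term (u : nat -> \bar R) j :
  (forall i, 0 <= u i)%E -> (u j <= \sum_(0 <= i <oo) u i)%E.
Proof.
move=> u0; apply: (le_trans _ (nneseries_lim_ge j.+1 _)) => //.
by rewrite big_nat_recr//= leeDr// sume_ge0.
Qed.

(** The part of [g] below [a] has averages at most [a], so [{M g > 2 a}] is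
    contained in [{M h > a}], where [h] majorizes the rest of [g] by the sum of
    [2 ^ (j + 1) * a] over the heights [2 ^ j * a] that [g] exceeds. Only the
    measures of the level sets of [g] appear on the right, which is the form that
    can be iterated. *)
Lemma rat_maximal_layer (g : measurableTypeR R -> \bar R) (a : R) :
  measurable_fun setT g -> (forall x, 0 <= g x)%E -> 0 < a ->
  (leb [set x | (2 * a)%:E < rat_maximal g x] <=
   \sum_(0 <= j <oo) (6 * 2 ^+ j)%:E * leb [set x | (2 ^+ j * a)%:E < g x])%E.
Proof.
move=> mg g0 a0.
pose L j : set (measurableTypeR R) := [set x | ((2 ^+ j * a)%:E < g x)%E].
have mL j : measurable (L j).
  by rewrite -[L j]setTI; exact: emeasurable_fun_o_infty.
pose t j (x : measurableTypeR R) := ((2 ^+ j.+1 * a)%:E * (\1_(L j) x)%:E)%E.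
have t0 j x : (0 <= t j x)%E.
  by rewrite /t -EFinM lee_fin mulr_ge0// mulr_ge0 ?exprn_ge0// ltW.
have mt j : measurable_fun setT (t j).
  by apply: measurable_funeM; apply/measurable_EFinP; exact: measurable_indic.
pose h x := (\sum_(0 <= j <oo) t j x)%E.
have mh : measurable_fun setT h by exact: ge0_emeasurable_sum.
have h0 x : (0 <= h x)%E by exact: nneseries_ge0.
have gh x : (g x <= a%:E + h x)%E.
  (* If [g x > a + h x], then [g x] exceeds all the heights [2 ^ j * a], one after
     the other, so that [h x] is infinite. *)
  rewrite leNgt; apply/negP => hg.
  have step j : ((2 ^+ j * a)%:E < g x)%E -> ((2 ^+ j.+1 * a)%:E <= h x)%E.
    move=> jg; apply: le_trans (nneseries_ge_term j (t0 ^~ x)).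
    by rewrite /t indicE mem_set// mule1.
  have all j : ((2 ^+ j * a)%:E < g x)%E.
    elim: j => [|j IH]; first by rewrite expr0 mul1r (le_lt_trans _ hg)// leeDl.
    by rewrite (le_lt_trans (step _ IH))// (le_lt_trans _ hg)// leeDr// lee_fin ltW.
  suff hy : h x = +oo%E by move: hg; rewrite hy addey// ltNge leey.
  apply/eq_infty => r.
  apply: (@le_trans _ _ (2 ^+ (Num.truncn `|r / a|).+1 * a)%:E); last exact: step.
  rewrite lee_fin -ler_pdivrMr// (le_trans (ler_norm _))//.
  rewrite (le_trans (ltW (truncnS_gt _)))//.
  by rewrite -natrX ler_nat ltnW// ltn_expl.
have sub : [set x | (2 * a)%:E < rat_maximal g x]%E `<=`
           [set x | a%:E < rat_maximal h x]%E.
  move=> x /= /rat_maximal_gt[m mx am]; apply/rat_maximal_gt; exists m => //.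
  have r0 := rat_radius_gt0 R m.
  have r20 : 0 < 2 * rat_radius R m by rewrite mulr_gt0.
  have : ((2 * a)%:E < a%:E + ball_average h m)%E.
    apply: (lt_le_trans am).
    have mah : measurable_fun setT (fun x => a%:E + h x)%E.
      by apply: (emeasurable_funD _ mh); exact: measurable_cst.
    apply: (le_trans (le_ball_average m mg mah g0 gh)).
    rewrite /ball_average (ge0_integralD _ (@measurable_rat_ball R m))//; last 2 first.
    - by move=> y _; rewrite lee_fin ltW.
    - exact: measurable_funTS.
    rewrite integral_cst; last exact: measurable_rat_ball.
    rewrite [X in (a%:E * X)%E](lebesgue_measure_ball _ (ltW r0)) muleDr//.
    rewrite leeD2r// -!EFinM lee_fin -[rat_radius R m *+ 2]mulr_natl.
    by rewrite mulrCA mulVf ?gt_eqF// mulr1.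
  have -> : (2 * a)%:E = (a%:E + a%:E)%E by rewrite -EFinD; congr EFin; ring.
  by rewrite lteD2lE.
apply: (@le_trans _ _ (leb [set x | a%:E < rat_maximal h x]%E)).
  exact: le_outer_measure.
apply: (le_trans (rat_maximal_weak11 mh h0 a0)).
rewrite integral_nneseries// -nneseriesZl; last by move=> i _; exact: integral_ge0.
apply: lee_nneseries => [j _ _|j _].
  by rewrite mule_ge0 ?integral_ge0// lee_fin divr_ge0// ltW.
rewrite ge0_integralZl//; last 2 first.
- by apply/measurable_EFinP; exact: measurable_indic.
- by rewrite lee_fin mulr_ge0// ltW.
rewrite integral_indic// setIT muleA -EFinM lee_wpmul2r// lee_fin.
by rewrite le_eqVlt; apply/orP; left; apply/eqP; rewrite exprS; field; rewrite gt_eqF.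
Qed.

End layers.

(** * Iterated maximal functions *)

Section borel_volume_fubini.
Context (R : realType) (n : nat).
Local Notation leb := (@lebesgue_measure R).
Local Notation X := (measurableTypeR R).

Lemma measurable_fun_cons_pair (h : n.+1.-tuple X -> \bar R) :
  measurable_fun setT h -> measurable_fun setT (h \o @cons_pair R n).
Proof. by move=> mh; apply: measurableT_comp => //; exact: measurable_cons_pair. Qed.

Lemma borel_volume_pairE (h : n.+1.-tuple X -> \bar R) :
  measurable_fun setT h -> (forall x, 0 <= h x)%E ->
  (\int[borel_volume R n.+1]_x h x =
   \int[(leb \x borel_volume R n)%E]_p h (cons_pair p))%E.
Proof.
move=> mh h0.
rewrite -[RHS](ge0_integral_pushforward (@measurable_cons_pair R n) _ measurableT)//.
Qed.

Lemma borel_volume_fubini (h : n.+1.-tuple X -> \bar R) :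
  measurable_fun setT h -> (forall x, 0 <= h x)%E ->
  (\int[borel_volume R n.+1]_x h x =
   \int[leb]_y \int[borel_volume R n]_s h (cons_pair (y, s)))%E.
Proof.
move=> mh h0; rewrite borel_volume_pairE//.
by rewrite (fubini_tonelli1 _ (measurable_fun_cons_pair mh) (fun p => h0 _)).
Qed.

Lemma borel_volume_fubini_swap (h : n.+1.-tuple X -> \bar R) :
  measurable_fun setT h -> (forall x, 0 <= h x)%E ->
  (\int[borel_volume R n.+1]_x h x =
   \int[borel_volume R n]_s \int[leb]_y h (cons_pair (y, s)))%E.
Proof.
move=> mh h0; rewrite borel_volume_pairE//.
have mc := measurable_fun_cons_pair mh.
by rewrite (fubini_tonelli1 _ mc (fun p => h0 _)) (fubini_tonelli _ mc (fun p => h0 _)).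
Qed.

End borel_volume_fubini.

Section iterated_maximal.
Context (R : realType).
Local Notation leb := (@lebesgue_measure R).
Local Notation X := (measurableTypeR R).

Definition tail_tuple n (x : n.+1.-tuple X) : n.-tuple X := [tuple of behead x].

Lemma cons_pairK n (y : X) (s : n.-tuple X) :
  tail_tuple (cons_pair (y, s)) = s /\ tnth (cons_pair (y, s)) ord0 = y.
Proof. by split => //; exact: val_inj. Qed.

Lemma cons_pair_eta n (x : n.+1.-tuple X) :
  cons_pair (tnth x ord0, tail_tuple x) = x.
Proof. by apply: val_inj; case/tupleP: x => y s /=. Qed.

Fixpoint iter_maximal n : (n.-tuple X -> \bar R) -> n.-tuple X -> \bar R :=
  match n with
  | 0 => fun f => f
  | m.+1 => fun f x => rat_maximal
      (fun y => iter_maximal (fun s => f (cons_pair (y, s))) (tail_tuple x))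
      (tnth x ord0)
  end.

Lemma rat_maximal_ge0 (g : X -> \bar R) y : (forall x, 0 <= g x)%E ->
  (0 <= rat_maximal g y)%E.
Proof.
move=> g0; have [m [sub _]] := @rat_ball_cover R y 1 ltr01.
have my : rat_ball m y by apply: sub => /=; rewrite in_itv/= lexx lerDl ler01.
apply: (@le_trans _ _ (ball_average g m)); last first.
  by apply: ereal_sup_ubound; exists m.
rewrite mule_ge0 ?integral_ge0// lee_fin invr_ge0 mulr_ge0// ltW//.
exact: rat_radius_gt0.
Qed.

Lemma iter_maximal_ge0 n (f : n.-tuple X -> \bar R) x :
  (forall x, 0 <= f x)%E -> (0 <= iter_maximal f x)%E.
Proof.
elim: n => [//|n IH] in f x * => f0 /=.
by apply: rat_maximal_ge0 => y; exact: IH.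
Qed.

(** The iteration integrates the maximal function of one group of variables with
    respect to another one, so measurability is needed jointly with an arbitrary
    parameter. *)
Lemma measurable_param_rat_maximal d (T : measurableType d) (G : T * X -> \bar R) :
  measurable_fun setT G -> (forall p, 0 <= G p)%E ->
  measurable_fun setT (fun p : T * X => rat_maximal (fun y => G (p.1, y)) p.2).
Proof.
move=> mG G0.
have mavg m : measurable_fun setT (fun t : T => ball_average (fun y => G (t, y)) m).
  apply: measurable_funeM.
  pose H := G \_ (setT `*` (rat_ball m : set X)).
  have mB : measurable (setT `*` (rat_ball m : set X) : set (T * X)).
    by apply: measurableX => //; exact: measurable_rat_ball.
  have mH : measurable_fun setT H.
    by apply/(measurable_restrictT _ mB); exact: measurable_funTS.
  have H0 p : (0 <= H p)%E by exact: erestrict_ge0.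
  rewrite [X in measurable_fun _ X](_ : _ = fubini_F leb H).
    exact: measurable_fun_fubini_tonelli_F.
  apply/funext => t; rewrite /fubini_F [LHS]integral_mkcond.
  apply: eq_integral => y _; rewrite /H /patch /=.
  have [yB|yB] := boolP (y \in rat_ball m).
    by rewrite mem_set//; split => //; exact: set_mem.
  rewrite memNset// => -[_ /= yB']; move: yB; rewrite notin_setE; exact.
apply: (measurability _ (ErealGenOInfty.measurableE R)) => //.
move=> _ [_ [r ->] <-]; rewrite setTI.
rewrite [X in measurable X](_ : _ = \bigcup_m
   ([set t : T | (r%:E < ball_average (fun y => G (t, y)) m)%E] `*` (rat_ball m : set X))).
  apply: bigcupT_measurable => m; apply: measurableX; last exact: measurable_rat_ball.
  by rewrite -[X in measurable X]setTI; exact: emeasurable_fun_o_infty.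
apply/seteqP; split => -[t y] /=.
  by rewrite in_itv/= andbT => /rat_maximal_gt[m my ry]; exists m.
by move=> [m _ [/= ry my]]; rewrite in_itv/= andbT; apply/rat_maximal_gt; exists m.
Qed.

Lemma measurable_param_iter_maximal n d (T : measurableType d)
    (f : T * n.-tuple X -> \bar R) :
  measurable_fun setT f -> (forall p, 0 <= f p)%E ->
  measurable_fun setT (fun p : T * n.-tuple X => iter_maximal (fun s => f (p.1, s)) p.2).
Proof.
elim: n d T f => [|n IH] d T f mf f0.
  by rewrite [X in measurable_fun _ X](_ : _ = f)//; apply/funext => -[].
pose f' (q : (T * X) * n.-tuple X) := f (q.1.1, cons_pair (q.1.2, q.2)).
have mf' : measurable_fun setT f'.
  apply: (measurableT_comp mf); apply/measurable_fun_pairP; split => /=.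
    exact: (measurableT_comp measurable_fst measurable_fst).
  apply: (measurableT_comp (@measurable_cons_pair R n)).
  apply/measurable_fun_pairP; split.
    exact: (measurableT_comp measurable_snd measurable_fst).
  exact: measurable_snd.
have := IH _ _ f' mf' (fun q => f0 _) => mG.
pose G (q : (T * n.-tuple X) * X) :=
  iter_maximal (fun s => f' ((q.1.1, q.2), s)) q.1.2.
have mG' : measurable_fun setT G.
  pose sw (q : (T * n.-tuple X) * X) := ((q.1.1, q.2), q.1.2).
  have msw : measurable_fun setT sw.
    apply/measurable_fun_pairP; split => /=; last first.
      exact: (measurableT_comp measurable_snd measurable_fst).
    apply/measurable_fun_pairP; split; last exact: measurable_snd.
    exact: (measurableT_comp measurable_fst measurable_fst).
  exact: (measurableT_comp mG msw).
have G0 q : (0 <= G q)%E by apply: iter_maximal_ge0 => s; exact: f0.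
have mM := measurable_param_rat_maximal mG' G0.
pose un (p : T * n.+1.-tuple X) := ((p.1, tail_tuple p.2), tnth p.2 ord0).
have mun : measurable_fun setT un.
  apply/measurable_fun_pairP; split => /=.
    apply/measurable_fun_pairP; split; first exact: measurable_fst.
    exact: (measurableT_comp (@measurable_behead _ X n) measurable_snd).
  exact: (measurableT_comp (measurable_tnth ord0) measurable_snd).
exact: (measurableT_comp mM mun).
Qed.

Lemma measurable_iter_maximal n (f : n.-tuple X -> \bar R) :
  measurable_fun setT f -> (forall x, 0 <= f x)%E ->
  measurable_fun setT (iter_maximal f).
Proof.
move=> mf f0.
have mf' : measurable_fun setT (fun p : unit * n.-tuple X => f p.2).
  exact: measurableT_comp.
have := measurable_param_iter_maximal mf' (fun p => f0 _) => mG.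
have mi : measurable_fun setT (fun s : n.-tuple X => (tt, s)).
  by apply/measurable_fun_pairP; split; [exact: measurable_cst|exact: measurable_id].
exact: (measurableT_comp mG mi).
Qed.

End iterated_maximal.

(** * Weak type inequality for iterated maximal functions *)

Section iterated_weak_type.
Context (R : realType).
Local Notation leb := (@lebesgue_measure R).
Local Notation X := (measurableTypeR R).

(** The gauge that iterating [rat_maximal_layer] produces. The first coordinate
    turns the indicator of [u > 1] into a multiple of [u], and each further one
    brings in a logarithm. *)
Fixpoint layer_gauge n (u : R) : \bar R :=
  match n with
  | 0 => (\1_(`]1, +oo[%classic : set R) u)%:E
  | m.+1 => (\sum_(0 <= j <oo) (2 ^+ j)%:E * layer_gauge m (u / 2 ^+ j))%E
  end.

Lemma layer_gauge_ge0 n u : (0 <= layer_gauge n u)%E.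
Proof.
elim: n => [|n IH] in u *; first by rewrite lee_fin.
by apply: nneseries_ge0 => j _ _; rewrite mule_ge0// lee_fin exprn_ge0.
Qed.

Lemma measurable_layer_gauge n : measurable_fun setT (layer_gauge n).
Proof.
elim: n => [|n IH] /=.
  by apply/measurable_EFinP; apply: measurable_indic; exact: measurable_itv.
apply: ge0_emeasurable_sum => [j x _ _|j _].
  by rewrite mule_ge0 ?layer_gauge_ge0// lee_fin exprn_ge0.
apply: measurable_funeM; apply: (measurableT_comp IH).
exact: measurable_funM.
Qed.

Lemma measurable_layer_gauge_comp d (T : measurableType d) n (f : T -> R) (a : R) :
  measurable_fun setT f -> measurable_fun setT (fun x => layer_gauge n (f x / a)).
Proof.
move=> mf; apply: (measurableT_comp (@measurable_layer_gauge n)).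
exact: measurable_funM.
Qed.

Lemma measure_as_integral d (T : measurableType d) (mu : {measure set T -> \bar R})
  (A : set T) : measurable A -> (mu A = \int[mu]_x (\1_A x)%:E)%E.
Proof. by move=> mA; rewrite integral_indic// setIT. Qed.

(** Induction on the dimension. For fixed last coordinates, [rat_maximal_layer]
    bounds the measure of the section of the level set; after exchanging the order
    of integration, the sections in the other direction are level sets of the
    [n]-dimensional maximal function, at the heights [2 ^ j * 2 ^ n * a]. *)
Lemma iter_maximal_weak n (f : n.-tuple X -> R) (a : R) :
  measurable_fun setT f -> (forall x, 0 <= f x) -> 0 < a ->
  (borel_volume R n [set x | (2 ^+ n * a)%:E < iter_maximal (EFin \o f) x] <=
   (6 ^+ n)%:E * \int[borel_volume R n]_x layer_gauge n (f x / a))%E.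
Proof.
elim: n f a => [|n IH] f a mf f0 a0.
  rewrite !expr0 mul1e mul1r (_ : [set x | _] = [set x | 1 < f x / a]); last first.
    by apply/seteqP; split => x /=; rewrite lte_fin ltr_pdivlMr// mul1r.
  rewrite measure_as_integral; last first.
    rewrite (_ : [set x | _] = (fun x => f x / a) @^-1` `]1, +oo[); last first.
      by apply/seteqP; split => x /=; rewrite in_itv/= andbT.
    rewrite -[X in measurable X]setTI.
    have mfa : measurable_fun setT (fun x => f x / a) by exact: measurable_funM.
    by apply: mfa => //; exact: measurable_itv.
  rewrite le_eqVlt; apply/orP; left; apply/eqP; apply: eq_integral => x _ /=.
  congr EFin; rewrite !indicE; congr ((nat_of_bool _)%:R).
  by apply/idP/idP; rewrite !inE /= in_itv/= andbT.
have mEf : measurable_fun setT (EFin \o f) by exact/measurable_EFinP.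
have Ef0 x : (0 <= (EFin \o f) x)%E by rewrite lee_fin.
pose fy (y : X) (s : n.-tuple X) := f (cons_pair (y, s)).
have mfp : measurable_fun setT (f \o @cons_pair R n).
  by apply: (measurableT_comp mf); exact: measurable_cons_pair.
have mfy y : measurable_fun setT (fy y).
  exact: (measurableT_comp mfp (pair1_measurable y)).
pose g (p : X * n.-tuple X) := iter_maximal (EFin \o fy p.1) p.2.
have mg : measurable_fun setT g.
  apply: (@measurable_param_iter_maximal R n _ X (EFin \o (f \o @cons_pair R n))).
    by apply/measurable_EFinP; exact: mfp.
  by move=> p; rewrite lee_fin; exact: f0.
have g0 p : (0 <= g p)%E by apply: iter_maximal_ge0 => s; rewrite lee_fin; exact: f0.
have mgs s : measurable_fun setT (fun y => g (y, s)).
  exact: (measurableT_comp mg (pair2_measurable s)).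
pose b := 2 ^+ n * a.
have b0 : 0 < b by rewrite mulr_gt0// exprn_gt0.
set A := [set x | _].
have mA : measurable A.
  rewrite -[A]setTI; apply: emeasurable_fun_o_infty => //.
  exact: measurable_iter_maximal.
have mL j : measurable [set p : X * n.-tuple X | (2 ^+ j * b)%:E < g p]%E.
  by rewrite -[X in measurable X]setTI; exact: emeasurable_fun_o_infty.
have slice s : (\int[leb]_y (\1_A (cons_pair (y, s)))%:E)%E =
    leb [set y | (2 * b)%:E < rat_maximal (fun y => g (y, s)) y]%E.
  rewrite measure_as_integral; last first.
    rewrite -[X in measurable X]setTI; apply: emeasurable_fun_o_infty => //.
    have mGs : measurable_fun setT (fun p : unit * X => g (p.2, s)).
      exact: (measurableT_comp (mgs s) measurable_snd).
    have := measurable_param_rat_maximal mGs (fun p => g0 _).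
    move=> /measurableT_comp /(_ (pair1_measurable tt)); exact.
  apply: eq_integral => y _; congr EFin; rewrite !indicE; congr ((nat_of_bool _)%:R).
  have -> : 2 * b = 2 ^+ n.+1 * a by rewrite /b mulrA -exprS.
  by apply/idP/idP; rewrite !inE /A /= (cons_pairK y s).1.
have mIA : measurable_fun setT (fun x => (\1_A x)%:E : \bar R).
  by apply/measurable_EFinP; exact: measurable_indic.
have IA0 x : (0 <= (\1_A x)%:E :> \bar R)%E by rewrite lee_fin.
rewrite measure_as_integral// (borel_volume_fubini_swap mIA IA0).
under eq_integral do rewrite slice.
pose iL j (p : X * n.-tuple X) : \bar R :=
  (\1_[set p : X * n.-tuple X | (2 ^+ j * b)%:E < g p]%E p)%:E.
have mDL j : measurable_fun setT (iL j).
  by apply/measurable_EFinP; exact: measurable_indic.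
have DL0 j p : (0 <= iL j p)%E.
  by rewrite lee_fin.
have sliceG j s : leb [set y | (2 ^+ j * b)%:E < g (y, s)]%E =
    fubini_G leb (iL j) s.
  rewrite measure_as_integral//.
  by rewrite -[X in measurable X]setTI; exact: emeasurable_fun_o_infty.
have mslice j : measurable_fun setT
    (fun s => leb [set y | (2 ^+ j * b)%:E < g (y, s)]%E).
  under eq_fun do rewrite sliceG.
  exact: measurable_fun_fubini_tonelli_G.
have sliceE j : (\int[borel_volume R n]_s leb [set y | (2 ^+ j * b)%:E < g (y, s)]%E =
   \int[leb]_y borel_volume R n [set s | (2 ^+ j * b)%:E < g (y, s)]%E)%E.
  under eq_integral do rewrite sliceG.
  rewrite -(fubini_tonelli _ (mDL j) (DL0 j)); apply: eq_integral => y _.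
  rewrite measure_as_integral//.
  rewrite -[X in measurable X]setTI; apply: emeasurable_fun_o_infty => //.
  exact: (measurableT_comp mg (pair1_measurable y)).
have mlg j : measurable_fun setT (fun x => layer_gauge n (f x / a / 2 ^+ j)).
  by apply: measurable_layer_gauge_comp; exact: measurable_funM.
have lg0 j x : (0 <= layer_gauge n (f x / a / 2 ^+ j))%E by exact: layer_gauge_ge0.
have key j : (\int[leb]_y borel_volume R n [set s | (2 ^+ j * b)%:E < g (y, s)]%E <=
    (6 ^+ n)%:E * \int[borel_volume R n.+1]_x layer_gauge n (f x / a / 2 ^+ j))%E.
  rewrite (borel_volume_fubini (mlg j) (lg0 j)).
  have mF : measurable_fun setT (fun y => \int[borel_volume R n]_s
      layer_gauge n (f (cons_pair (y, s)) / a / 2 ^+ j))%E.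
    apply: (@measurable_fun_fubini_tonelli_F _ _ X _ R (borel_volume R n)
      (fun p => layer_gauge n (f (cons_pair p) / a / 2 ^+ j))) => //.
    exact: (measurable_fun_cons_pair (mlg j)).
  have c6 : (0 <= (6 ^+ n)%:E :> \bar R)%E by rewrite lee_fin exprn_ge0.
  rewrite -(ge0_integralZl leb measurableT mF _ c6); last first.
    by move=> y _; apply: integral_ge0.
  apply: ge0_le_integral => //.
  - apply: (eq_measurable_fun (fubini_F (borel_volume R n) (iL j))).
      move=> y _; rewrite [RHS]measure_as_integral//.
      rewrite -[X in measurable X]setTI; apply: emeasurable_fun_o_infty => //.
      exact: (measurableT_comp mg (pair1_measurable y)).
    exact: measurable_fun_fubini_tonelli_F.
  - exact: measurable_funeM.
  move=> y _; have aj0 : 0 < 2 ^+ j * a by rewrite mulr_gt0// exprn_gt0.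
  have := IH (fy y) (2 ^+ j * a) (mfy y) (fun s => f0 _) aj0.
  rewrite mulrCA -/b => /le_trans; apply; rewrite lee_wpmul2l ?lee_fin ?exprn_ge0//.
  rewrite le_eqVlt; apply/orP; left; apply/eqP; apply: eq_integral => s _.
  by congr layer_gauge; rewrite /fy -mulrA -invfM [a * _]mulrC.
have c0 j : (0 <= (6 * 2 ^+ j)%:E :> \bar R)%E by rewrite lee_fin mulr_ge0// exprn_ge0.
have mser : measurable_fun setT (fun s => \sum_(0 <= j <oo)
    (6 * 2 ^+ j)%:E * leb [set y | (2 ^+ j * b)%:E < g (y, s)])%E.
  apply: ge0_emeasurable_sum => [j x _ _|j _]; first by rewrite mule_ge0.
  exact: measurable_funeM.
apply: (@le_trans _ _ (\int[borel_volume R n]_s (\sum_(0 <= j <oo)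
    (6 * 2 ^+ j)%:E * leb [set y | (2 ^+ j * b)%:E < g (y, s)]))%E).
  apply: ge0_le_integral => //.
    under eq_fun do rewrite -slice.
    apply: (@measurable_fun_fubini_tonelli_G _ _ X _ R leb
      (fun p => (\1_A (cons_pair p))%:E)) => [|p]; last by rewrite lee_fin.
    exact: (measurable_fun_cons_pair mIA).
  by move=> s _; apply: rat_maximal_layer.
rewrite integral_nneseries//; last 2 first.
- by move=> j; exact: measurable_funeM.
- by move=> j s _; rewrite mule_ge0.
apply: (@le_trans _ _ (\sum_(0 <= j <oo) (6 ^+ n.+1)%:E *
    ((2 ^+ j)%:E * \int[borel_volume R n.+1]_x layer_gauge n (f x / a / 2 ^+ j)))%E).
  apply: lee_nneseries => [j _ _|j _].
    by rewrite integral_ge0// => s _; rewrite mule_ge0.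
  rewrite ge0_integralZl// sliceE.
  apply: (le_trans (lee_wpmul2l (c0 j) (key j))).
  rewrite !muleA -!EFinM lee_wpmul2r ?integral_ge0// lee_fin exprS.
  by rewrite le_eqVlt; apply/orP; left; apply/eqP; ring.
rewrite nneseriesZl; last first.
  by move=> j _; rewrite mule_ge0 ?lee_fin ?exprn_ge0// integral_ge0// => x _;
    exact: layer_gauge_ge0.
rewrite lee_wpmul2l// ?lee_fin ?exprn_ge0//.
rewrite [X in (_ <= X)%E]integral_nneseries//; last 2 first.
- by move=> j; exact: measurable_funeM.
- by move=> j x _; rewrite mule_ge0 ?lee_fin ?exprn_ge0.
apply: lee_nneseries => [j _ _|j _].
  by rewrite mule_ge0 ?lee_fin ?exprn_ge0// integral_ge0.
by rewrite ge0_integralZl// lee_fin exprn_ge0.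
Qed.

End iterated_weak_type.

Section layer_gauge_bound.
Context (R : realType).

Lemma log2_pow2 j : log2 (2 ^+ j : R) = j%:R.
Proof.
by rewrite /log2 lnXn ?ltr0n// -[X in X / _ = _]mulr_natl mulfK// gt_eqF// ln_gt0// ltr1n.
Qed.

Lemma ler_log2 (u v : R) : 0 < u -> u <= v -> log2 u <= log2 v.
Proof.
move=> u0 uv; rewrite /log2 ler_pM2r ?invr_gt0 ?ln_gt0 ?ltr1n//.
by rewrite ler_ln// posrE// (lt_le_trans u0).
Qed.

Lemma log2p_ge0 (u : R) : 0 <= log2p u.
Proof. by rewrite /log2p le_max lexx orbT. Qed.

Lemma ler_log2p (u v : R) : 0 <= u -> u <= v -> log2p u <= log2p v.
Proof.
rewrite le_eqVlt => /predU1P[<-|u0] uv.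
  by rewrite {1}/log2p /log2 ln0// mul0r maxxx log2p_ge0.
by rewrite /log2p ge_max !le_max lexx orbT andbT ler_log2.
Qed.

Lemma layer_gauge_eq0 n (u : R) : u <= 1 -> layer_gauge n u = 0%E.
Proof.
elim: n u => [|n IH] u u1 /=.
  rewrite indicE memNset//= in_itv/= andbT; apply/negP; by rewrite -leNgt.
rewrite eseries0// => j _ _; rewrite IH ?mule0// ler_pdivrMr ?exprn_gt0// mul1r.
by rewrite (le_trans u1)// exprn_ege1// ler1n.
Qed.

(** The logarithm of the theorem comes from here: each coordinate after the first
    contributes the number of dyadic heights below [u]. *)
Lemma dyadic_count (u : R) N :
  \sum_(0 <= j < N | 2 ^+ j < u) (1 : R) <= 1 + log2p u.
Proof.
have u0 : 0 <= 1 + log2p u by rewrite addr_ge0// log2p_ge0.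
elim: N => [|N IH]; first by rewrite big_nil.
case: (ltP (2 ^+ N) u) => Nu; last first.
  by rewrite big_mkcond big_nat_recr//= -big_mkcond/= ltNge Nu/= addr0.
apply: (@le_trans _ _ (N.+1%:R)).
  rewrite big_mkcond/= (le_trans (ler_sum _ (G := fun=> 1) _))//.
    by move=> i _; case: ifP.
  by rewrite sumr_const_nat subn0.
rewrite -natr1 addrC lerD2l -log2_pow2.
by rewrite /log2p le_max ler_log2 ?exprn_gt0// ltW.
Qed.

Lemma dyadic_sum (u : R) N : 0 <= u ->
  \sum_(0 <= j < N | 2 ^+ j < u) (2 ^+ j : R) <= 2 * u.
Proof.
move=> u0; elim: N => [|N IH]; first by rewrite big_nil mulr_ge0.
case: (ltP (2 ^+ N) u) => Nu; last first.
  by rewrite big_mkcond big_nat_recr//= -big_mkcond/= ltNge Nu/= addr0.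
apply: (@le_trans _ _ (2 ^+ N.+1)); last by rewrite exprS ler_pM2l// ltW.
apply: (@le_trans _ _ (\sum_(0 <= j < N.+1) 2 ^+ j)).
  by rewrite big_mkcond/= ler_sum// => i _; case: ifP => // _; exact: exprn_ge0.
elim: {Nu IH} N.+1 => [|M IH]; first by rewrite big_nil exprn_ge0.
by rewrite big_nat_recr//= exprS mulr_natl mulr2n lerD2r.
Qed.

(** In the sum defining [layer_gauge n.+2 u], the terms with [2 ^ j >= u] vanish and
    the induction hypothesis bounds each of the others by
    [2 * u * (1 + log2p u) ^ n], independently of [j]. *)
Lemma layer_gauge_le n (u : R) : 0 <= u ->
  (layer_gauge n.+1 u <= (2 * u * (1 + log2p u) ^+ n)%:E)%E.
Proof.
have term0 m j (v : R) : ~~ (2 ^+ j < v) -> layer_gauge m (v / 2 ^+ j) = 0%E.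
  rewrite -leNgt => vj; rewrite layer_gauge_eq0//.
  by rewrite ler_pdivrMr ?exprn_gt0// mul1r.
have bound m (c : nat -> R) (v B : R) : 0 <= v ->
    (forall j, 2 ^+ j < v ->
      ((2 ^+ j)%:E * layer_gauge m (v / 2 ^+ j) <= (c j)%:E)%E) ->
    (forall N, \sum_(0 <= j < N | 2 ^+ j < v) c j <= B) ->
    (layer_gauge m.+1 v <= B%:E)%E.
  move=> v0 cP BP /=; apply: lime_le.
    apply: is_cvg_nneseries => j _ _.
    by rewrite mule_ge0 ?lee_fin ?exprn_ge0 ?layer_gauge_ge0.
  apply: nearW => N.
  apply: (@le_trans _ _ (\sum_(0 <= j < N) (if 2 ^+ j < v then c j else 0)%:E)%E).
    apply: lee_sum => j _; case: ifPn => [/cP//|/(term0 m) ->].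
    by rewrite mule0.
  by rewrite sumEFin lee_fin -big_mkcond.
elim: n u => [|n IH] u u0.
  rewrite expr0 mulr1; apply: (bound _ (fun j => 2 ^+ j)) => // [j ju|N].
    by rewrite -EFinM lee_fin ler_piMr ?exprn_ge0// indicE; case: (_ \in _).
  exact: dyadic_sum.
have l0 := log2p_ge0 u.
apply: (bound _ (fun=> 2 * u * (1 + log2p u) ^+ n)) => // [j ju|N].
  have v0 : 0 <= u / 2 ^+ j by rewrite divr_ge0// exprn_ge0.
  apply: (le_trans (lee_wpmul2l _ (IH _ v0))); first by rewrite lee_fin exprn_ge0.
  rewrite -EFinM lee_fin !mulrA [2 ^+ j * 2]mulrC -[2 * _ * u]mulrA.
  rewrite -[2 * _ / _]mulrA [2 ^+ j * u]mulrC mulfK ?gt_eqF ?exprn_gt0//.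
  rewrite ler_wpM2l ?mulr_ge0// lerXn2r ?nnegrE ?addr_ge0 ?log2p_ge0//.
  rewrite lerD2l ler_log2p// ler_pdivrMr ?exprn_gt0// ler_peMr//.
  by rewrite exprn_ege1// ler1n.
rewrite exprSr mulrA (eq_bigr (fun=> 2 * u * (1 + log2p u) ^+ n * 1)); last first.
  by move=> j _; rewrite mulr1.
by rewrite -mulr_sumr ler_wpM2l ?dyadic_count// mulr_ge0 ?exprn_ge0 ?addr_ge0 ?mulr_ge0.
Qed.

End layer_gauge_bound.

(** * Volumes of boxes and averages over boxes *)

Section boxes.
Context (R : realType).
Local Notation leb := (@lebesgue_measure R).
Local Notation X := (measurableTypeR R).

Definition tuple_box n (I : 'I_n -> set X) : set (n.-tuple X) :=
  [set x | forall i, I i (tnth x i)].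

Lemma measurable_tuple_box n (I : 'I_n -> set X) :
  (forall i, measurable (I i)) -> measurable (tuple_box I).
Proof.
move=> mI.
rewrite (_ : tuple_box I =
  \bigcap_(i in [set: 'I_n]) ((fun x => tnth x i) @^-1` I i)).
  apply: fin_bigcap_measurable => [|i _]; first exact: finite_finset.
  by rewrite -[X in measurable X]setTI; apply: measurable_tnth.
by apply/seteqP; split => x xI i; [move=> _; exact: xI|exact: (xI i)].
Qed.

Lemma tuple_box_cons n (I : 'I_n.+1 -> set X) y s :
  tuple_box I (cons_pair (y, s)) <->
  I ord0 y /\ tuple_box (fun i => I (lift ord0 i)) s.
Proof.
split.
  move=> H; split; first by have := H ord0; rewrite (cons_pairK y s).2.
  by move=> i; have := H (lift ord0 i); rewrite tnthS.
move=> [H0 H1] i; case: (unliftP ord0 i) => [j ->|->].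
  by rewrite tnthS; exact: H1.
by rewrite (cons_pairK y s).2.
Qed.

Lemma borel_volume_box n (I : 'I_n -> set X) : (forall i, measurable (I i)) ->
  borel_volume R n (tuple_box I) = (\prod_(i < n) leb (I i))%E.
Proof.
elim: n I => [|n IH] I mI.
  rewrite big_ord0 /= diracE mem_set//; by case.
rewrite big_ord_recl -IH//.
transitivity ((leb \x borel_volume R n)%E
  (I ord0 `*` tuple_box (fun i => I (lift ord0 i)))).
  rewrite [LHS]/= /cons_measure /pushforward; congr ((_ \x _)%E _).
  by apply/seteqP; split => -[y s] /tuple_box_cons.
by rewrite product_measure1E//; exact: measurable_tuple_box.
Qed.

(** An average over a product of intervals is an iterated average, and each of the
    successive one-dimensional averages is bounded by a one-dimensional maximal
    function. *)
Lemma integral_rat_box_le n (m : 'I_n -> nat) (f : n.-tuple X -> \bar R) x :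
  measurable_fun setT f -> (forall x, 0 <= f x)%E ->
  tuple_box (fun i => rat_ball (m i)) x ->
  (\int[borel_volume R n]_(y in tuple_box (fun i => rat_ball (m i))) f y <=
   (\prod_(i < n) (2 * rat_radius R (m i)))%:E * iter_maximal f x)%E.
Proof.
elim: n m f x => [|n IH] m f x mf f0 mx.
  rewrite big_ord0 mul1e /= integral_dirac//.
  - by rewrite [x]tuple0 diracE mem_set ?mul1e//; case.
  - by rewrite (_ : tuple_box _ = setT)//; apply/seteqP; split => // s _; case.
  - exact: measurable_funTS.
set B := tuple_box _.
have mB : measurable B.
  by apply: measurable_tuple_box => i; exact: measurable_rat_ball.
have mfB : measurable_fun setT (f \_ B).
  by apply/(measurable_restrictT _ mB); exact: measurable_funTS.
have fB0 y : (0 <= (f \_ B) y)%E by exact: erestrict_ge0.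
rewrite [leLHS](integral_mkcond B f) (borel_volume_fubini mfB fB0).
set m' := fun i : 'I_n => m (lift ord0 i).
set r' := (\prod_(i < n) (2 * rat_radius R (m' i))).
have r'0 : 0 <= r' by apply: prodr_ge0 => i _; rewrite mulr_ge0// ltW// rat_radius_gt0.
have [x0 xs] : rat_ball (m ord0) (tnth x ord0) /\
    tuple_box (fun i => rat_ball (m' i)) (tail_tuple x).
  by apply/(tuple_box_cons (fun i => rat_ball (m i))); rewrite cons_pair_eta.
have mfp : measurable_fun setT (f \o @cons_pair R n).
  by apply: (measurableT_comp mf); exact: measurable_cons_pair.
have mfy y : measurable_fun setT (fun s => f (cons_pair (y, s))).
  exact: (measurableT_comp mfp (pair1_measurable y)).
pose G y := iter_maximal (fun s => f (cons_pair (y, s))) (tail_tuple x).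
have mG : measurable_fun setT G.
  have := @measurable_param_iter_maximal R n _ X (f \o @cons_pair R n) mfp (fun p => f0 _).
  by move=> /measurableT_comp /(_ (pair2_measurable (tail_tuple x))); exact.
have G0 y : (0 <= G y)%E by apply: iter_maximal_ge0.
apply: (@le_trans _ _ (\int[leb]_(y in rat_ball (m ord0)) (r'%:E * G y))%E).
  rewrite [leRHS]integral_mkcond; apply: ge0_le_integral => //.
  - by move=> y _; exact: integral_ge0.
  - apply: (@measurable_fun_fubini_tonelli_F _ _ X _ R (borel_volume R n)
      (fun p => (f \_ B) (cons_pair p))) => //.
    exact: (measurable_fun_cons_pair mfB).
  - apply/(measurable_restrictT _ (@measurable_rat_ball R (m ord0))).
    by apply: measurable_funTS; exact: measurable_funeM.
  move=> y _; rewrite [leRHS]patchE; case: ifPn => yB.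
    have := IH m' _ _ (mfy y) (fun s => f0 _) xs.
    apply: le_trans; rewrite [leRHS]integral_mkcond.
    rewrite le_eqVlt; apply/orP; left; apply/eqP; apply: eq_integral => s _.
    rewrite !patchE; congr (if _ then _ else _).
    apply/idP/idP; rewrite !inE.
      by move=> /tuple_box_cons[].
    by move=> sB; apply/tuple_box_cons; split => //; exact: set_mem.
  rewrite integral0_eq// => s _; rewrite patchE memNset// => /tuple_box_cons[yB' _].
  by move: yB; rewrite notin_setE; exact.
rewrite ge0_integralZl//; last 2 first.
- exact: measurable_rat_ball.
- exact: measurable_funTS.
rewrite big_ord_recl mulrC EFinM -muleA lee_wpmul2l// ?lee_fin//.
have rr : 0 < 2 * rat_radius R (m ord0) by rewrite mulr_gt0// rat_radius_gt0.
rewrite -lee_pdivrMl//.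
by apply: ereal_sup_ubound; exists (m ord0).
Qed.

End boxes.

(** * Borel modifications of Lebesgue measurable functions *)

Section borel_modification.
Context (R : realType) (n : nat).
Local Notation X := (measurableTypeR R).
Local Notation bvol := (borel_volume R n).
Local Notation vol := (@volume R n).
Implicit Types (A : set (euclidean R n)).

Lemma volume_borel (A : set (n.-tuple X)) : measurable A -> vol A = bvol A.
Proof. by move=> mA; exact: (measurable_mu_extE bvol). Qed.

Lemma borel_lebesgue (A : set (n.-tuple X)) :
  measurable A -> measurable (A : set (euclidean R n)).
Proof. by move=> mA; apply: sub_caratheodory; exact: sub_sigma_algebra. Qed.

Lemma null_bigcup (F : nat -> set (n.-tuple X)) :
  (forall k, measurable (F k)) -> (forall k, bvol (F k) = 0%E) ->
  bvol (\bigcup_k F k) = 0%E.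
Proof.
move=> mF F0; apply/eqP; rewrite eq_le measure_ge0 andbT.
apply: (le_trans (measure_sigma_subadditive bvol _ _ (@subset_refl _ _))) => //.
  exact: bigcupT_measurable.
by rewrite eseries0// => k _ _; exact: F0.
Qed.

Lemma le_volume A A' : A `<=` A' -> (vol A <= vol A')%E.
Proof. exact: (le_outer_measure (bvol^*)%mu). Qed.

(** The outer measure is an infimum over countable covers by Borel sets; intersect
    nearly optimal covers. *)
Lemma borel_hull A : (vol A < +oo)%E ->
  exists H : set (n.-tuple X), [/\ measurable H, A `<=` H & vol H = vol A].
Proof.
move=> Aoo.
have fA : vol A \is a fin_num by rewrite ge0_fin_numE// outer_measure_ge0.
have cover (k : nat) : exists F : set (n.-tuple X),
    [/\ measurable F, A `<=` F & (vol F <= vol A + (k.+1%:R^-1)%:E)%E].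
  have k0 : 0 < k.+1%:R^-1 :> R by rewrite invr_gt0.
  have [_ [C [mC AC] <-] lt] := lb_ereal_inf_adherent k0 fA.
  exists (\bigcup_i C i); split => //; first exact: bigcupT_measurable.
  rewrite volume_borel; last exact: bigcupT_measurable.
  apply: le_trans (ltW lt).
  by apply: (measure_sigma_subadditive bvol) => //; exact: bigcupT_measurable.
have [F Fp] := choice cover.
exists (\bigcap_k F k).
have mF : measurable (\bigcap_k F k).
  by apply: bigcapT_measurable => k; have [] := Fp k.
have AF : A `<=` \bigcap_k F k by move=> x Ax k _; have [_ + _] := Fp k; exact.
split => //; apply/eqP; rewrite eq_le; apply/andP; split; last exact: le_volume.
apply/lee_addgt0Pr => e e0.
have [k ke] : exists k : nat, k.+1%:R^-1 <= e.
  exists (Num.truncn e^-1); rewrite invf_ple ?posrE// ltW//.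
  exact: truncnS_gt.
have [_ _ Fk] := Fp k; apply: (@le_trans _ _ (vol (F k))).
  by apply: le_volume => x; exact.
by rewrite (le_trans Fk)// leeD2l// lee_fin.
Qed.

Lemma lebesgue_borel_finite A : measurable A -> (vol A < +oo)%E ->
  exists H N : set (n.-tuple X), [/\ measurable H, measurable N, bvol N = 0%E &
    forall x, ~ N x -> (A x <-> H x)].
Proof.
move=> mA Aoo; have [H [mH AH HA]] := borel_hull Aoo.
have fA : vol A \is a fin_num by rewrite ge0_fin_numE// outer_measure_ge0.
have D0 : vol (H `\` A) = 0%E.
  have : (vol H = vol A + vol (H `\` A))%E.
    rewrite -[in LHS](setDUK AH) measureU//.
    - by apply: measurableD => //; exact: borel_lebesgue.
    - by rewrite setDIK.
  rewrite HA; move: (vol (H `\` A)) fA; case: (vol A) => // a [d| |] //= _ [].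
  by move=> /eqP; rewrite addrC -subr_eq subrr => /eqP <-.
have [|N [mN DN N0]] := @borel_hull (H `\` A); first by rewrite D0.
exists H, N; split => //; first by rewrite -volume_borel// N0.
move=> x Nx; split=> [/AH//|Hx]; apply: contrapT => nAx; apply: Nx; exact: DN.
Qed.

Lemma lebesgue_borel A : measurable A ->
  exists H N : set (n.-tuple X), [/\ measurable H, measurable N, bvol N = 0%E &
    forall x, ~ N x -> (A x <-> H x)].
Proof.
move=> mA; have [T UT Too] := sigma_finiteT bvol.
have fin k : exists HN : set (n.-tuple X) * set (n.-tuple X),
    [/\ measurable HN.1, measurable HN.2, bvol HN.2 = 0%E &
    forall x, ~ HN.2 x -> ((A `&` T k) x <-> HN.1 x)].
  have [mT Tk] := Too k.
  have [||H [N HN]] := @lebesgue_borel_finite (A `&` T k).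
  - by apply: measurableI => //; exact: borel_lebesgue.
  - apply: (@le_lt_trans _ _ (vol (T k))); first exact: le_volume.
    by rewrite volume_borel.
  by exists (H, N).
have [HN HNp] := choice fin.
exists (\bigcup_k (HN k).1), (\bigcup_k (HN k).2); split.
- by apply: bigcupT_measurable => k; have [] := HNp k.
- by apply: bigcupT_measurable => k; have [] := HNp k.
- by apply: null_bigcup => k; have [] := HNp k.
move=> x Nx; have Nk k : ~ (HN k).2 x by move=> Nk; apply: Nx; exists k.
split=> [Ax|[k _ Hk]].
  have : setT x by []. rewrite UT => -[k _ Tk]; exists k => //.
  by have [_ _ _ /(_ x (Nk k)) [+ _]] := HNp k; apply.
by have [_ _ _ /(_ x (Nk k)) [_ /(_ Hk)[]]] := HNp k.
Qed.

(** A Lebesgue measurable function is Borel off a Borel null set. This reduces the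
    weak type estimate to Borel functions, for which sections are measurable. *)
Lemma borel_modification (f : euclidean R n -> R) :
  measurable_fun setT f -> (forall x, 0 <= f x) ->
  exists g : n.-tuple X -> R, [/\ measurable_fun setT g, (forall x, 0 <= g x) &
    exists N, [/\ measurable N, bvol N = 0%E & forall x, ~ N x -> f x = g x]].
Proof.
move=> mf f0.
(* [q] enumerates the rationals, so that countably many level sets determine [f]. *)
pose q k : R := ratr (odflt 0 (unpickle k : option rat)).
have qP (r s : R) : r < s -> exists k, r < q k < s.
  move=> /rat_in_itvoo[p /itvP pi]; exists (pickle p).
  by rewrite /q pickleK /= !pi.
have mA k : measurable [set x | q k < f x].
  rewrite (_ : [set x | _] = setT `&` f @^-1` `]q k, +oo[); last first.
    by rewrite setTI; apply/seteqP; split => x /=; rewrite in_itv/= andbT.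
  by apply: mf => //; exact: measurable_itv.
have ex k : exists HN : set (n.-tuple X) * set (n.-tuple X),
    [/\ measurable HN.1, measurable HN.2, bvol HN.2 = 0%E &
    forall x, ~ HN.2 x -> (q k < f x <-> HN.1 x)].
  by have [H [N HN]] := lebesgue_borel (mA k); exists (H, N).
have [HN HNp] := choice ex.
pose N := \bigcup_k (HN k).2.
have mN : measurable N by apply: bigcupT_measurable => k; have [] := HNp k.
have N0 : bvol N = 0%E by apply: null_bigcup => k; have [] := HNp k.
pose g x := if x \in N then 0 else f x.
have gN x : ~ N x -> f x = g x by move=> Nx; rewrite /g memNset.
have g0 x : 0 <= g x by rewrite /g; case: ifP.
exists g; split => //; last by exists N.
apply: (measurability _ (RGenOInfty.measurableE R)) => //.
move=> _ [_ [r ->] <-]; rewrite setTI.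
have [r0|r0] := ltP r 0.
  rewrite (_ : _ @^-1` _ = setT)//; apply/seteqP; split => x //= _.
  by rewrite in_itv/= andbT (lt_le_trans r0).
rewrite (_ : _ @^-1` _ = \bigcup_(k in [set k | r < q k]) ((HN k).1 `\` N)).
  apply: bigcup_measurable => k _; apply: measurableD => //.
  by have [] := HNp k.
apply/seteqP; split => x /=; rewrite in_itv/= andbT.
  move=> rg; have [k /andP[rk kg]] := qP _ _ rg; exists k => //.
  have Nx : ~ N x by move=> Nx; move: rg; rewrite /g mem_set// ltNge r0.
  split=> //; have [_ _ _ /(_ x) [|+ _]] := HNp k; first by move=> Nk; apply: Nx; exists k.
  by apply; rewrite (gN _ Nx).
move=> [k rk [Hk Nx]]; rewrite -gN// (lt_trans rk)//.
have [_ _ _ /(_ x) [|_]] := HNp k; last exact.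
by move=> Nk; apply: Nx; exists k.
Qed.

Lemma volume_integral_borel (A : set (n.-tuple X)) (h : n.-tuple X -> \bar R) :
  measurable A -> measurable_fun setT h -> (forall x, 0 <= h x)%E ->
  (\int[vol]_(x in A) h x = \int[bvol]_(x in A) h x)%E.
Proof.
move=> mA mh h0.
have mid : measurable_fun setT (idfun : euclidean R n -> n.-tuple X).
  by move=> _ B mB; rewrite setTI; exact: borel_lebesgue.
rewrite [LHS](_ : _ =
  \int[pushforward vol (idfun : euclidean R n -> n.-tuple X)]_(x in A) h x)%E.
  apply: eq_measure_integral => B mB _; exact: volume_borel.
rewrite (ge0_integral_pushforward mid)//; exact: measurable_funTS.
Qed.

Lemma volume_integral_modification (A N : set (n.-tuple X))
    (F : euclidean R n -> \bar R) (h : n.-tuple X -> \bar R) :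
  measurable A -> measurable_fun setT F -> (forall x, 0 <= F x)%E ->
  measurable_fun setT h -> (forall x, 0 <= h x)%E ->
  measurable N -> bvol N = 0%E -> (forall x, ~ N x -> F x = h x) ->
  (\int[vol]_(x in A) F x = \int[bvol]_(x in A) h x)%E.
Proof.
move=> mA mF F0 mh h0 mN N0 Fh.
rewrite -volume_integral_borel//; apply: ge0_ae_eq_integral => //.
- exact: borel_lebesgue.
- exact: measurable_funTS.
- by apply: measurable_funTS => _ B mB; apply: borel_lebesgue; exact: mh.
- exists N; split; first exact: borel_lebesgue.
    exact: etrans (volume_borel mN) N0.
  move=> y /= ny; apply: contrapT => Ny; apply: ny => _.
  exact: Fh.
Qed.

End borel_modification.

(** * Weak type estimate for rare bases *)

Section interval_boxes.
Context (R : realType).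
Local Notation leb := (@lebesgue_measure R).
Local Notation X := (measurableTypeR R).

(** Reduces open, closed and half-open sides to a single case. *)
Lemma interval_sandwich (I : set R) : is_interval I ->
  (0 < leb I < +oo)%E -> exists e L : R,
  [/\ 0 < L, `]e, e + L[ `<=` I, I `<=` `[e, e + L] & leb I = L%:E].
Proof.
move=> /is_intervalP ->; rewrite lebesgue_measure_itv.
case: (Rhull I) => [[[|] a|[|]] [[|] b|[|]]] //=; rewrite ?lte_fin;
  try case: ifPn => //; rewrite ?ltxx ?andbF//
.
all: move=> ab _; exists a, (b - a).
all: rewrite (_ : a + (b - a) = b) ?subr_gt0; last by rewrite addrC subrK.
all: by split => // x /=; rewrite !in_itv/=; lra.
Qed.

Lemma interval_box_sides n (I : 'I_n -> set R) : interval_box I ->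
  exists e L : 'I_n -> R, volume (box I) = (\prod_(i < n) L i)%:E /\
    forall i, [/\ 0 < L i, `]e i, e i + L i[ `<=` I i,
      I i `<=` `[e i, e i + L i] & leb (I i) = (L i)%:E].
Proof.
move=> [Iitv]; rewrite (_ : box I = tuple_box I)//.
have mI i : measurable (I i : set X) by exact: is_interval_measurable.
rewrite volume_borel; last exact: measurable_tuple_box.
rewrite borel_volume_box// => /andP[P0 Poo].
have I0 i : (0 < leb (I i))%E.
  rewrite lt0e measure_ge0 andbT; apply/negP => /eqP Ii.
  by move: P0; rewrite (bigD1 i)//= Ii mul0e ltxx.
have Ioo i : (leb (I i) < +oo)%E.
  rewrite ltey; apply/negP => /eqP Ii.
  move: Poo; rewrite (bigD1 i)//= Ii gt0_mulye ?ltxx//.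
  by elim/big_ind: _ => //; exact: mule_gt0.
have side i : exists eL : R * R, [/\ 0 < eL.2, `]eL.1, eL.1 + eL.2[ `<=` I i,
      I i `<=` `[eL.1, eL.1 + eL.2] & leb (I i) = (eL.2)%:E].
  have [|e [L H]] := interval_sandwich (Iitv i); first by rewrite I0 Ioo.
  by exists (e, L).
have [eL eLP] := choice side.
exists (fun i => (eL i).1), (fun i => (eL i).2); split => //.
rewrite -prodEFin; apply: eq_bigr => i _.
by have [] := eLP i.
Qed.

End interval_boxes.

Section strong_maximal_weak_type.
Context (R : realType).
Local Notation X := (measurableTypeR R).

Lemma measurable_log_gauge k : measurable_fun setT (fun u : R => u * (1 + log2p u) ^+ k).
Proof.
apply: measurable_funM => //; apply: measurable_funX.
apply: measurable_funD => //; apply: measurable_maxr => //.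
by apply: measurable_funM => //; exact: measurable_ln.
Qed.

(** The dilation by [2 ^+ k] of the gauge, caused by the constants of the maximal
    inequalities, is absorbed in the constant of the weak type estimate. *)
Lemma log2p_mul_pow2 k (u : R) : 0 <= u -> log2p (2 ^+ k * u) <= k%:R + log2p u.
Proof.
rewrite le_eqVlt => /predU1P[<-|u0].
  by rewrite mulr0 lerDr.
have k0 : 0 < 2 ^+ k :> R by rewrite exprn_gt0.
rewrite {1}/log2p ge_max addr_ge0 ?log2p_ge0// andbT.
rewrite /log2 lnM ?posrE// mulrDl -/(log2 (2 ^+ k)) log2_pow2 lerD2l.
by rewrite /log2p le_max lexx.
Qed.

(** The null set [N] does not affect averages, so the bound holds at every point [x],
    even though [f] is replaced by a Borel function [g]. *)
Lemma maximal_operator_le n (B : set (set (euclidean R n)))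
    (f : euclidean R n -> R) (g : n.-tuple X -> R) N x :
  rare_basis B -> measurable_fun setT f ->
  measurable_fun setT g -> (forall x, 0 <= g x) ->
  measurable N -> borel_volume R n N = 0%E ->
  (forall x, ~ N x -> `|f x| = g x) ->
  (maximal_operator B f x <= (2 ^+ n)%:E * iter_maximal (EFin \o g) x)%E.
Proof.
move=> [_ Bbox _] mf mg g0 mN N0 fg.
have mEg : measurable_fun setT (EFin \o g) by exact/measurable_EFinP.
have Eg0 y : (0 <= (EFin \o g) y)%E by rewrite lee_fin.
apply: ge_ereal_sup => _ [A [BA Ax] <-].
have [I ibI AI] := Bbox _ BA; subst A.
have [e [L [vL sides]]] := interval_box_sides ibI.
have ex i : exists m, `[e i, e i + L i] `<=` rat_ball m /\ rat_radius R m <= L i.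
  by have [L0 _ _ _] := sides i; exact: rat_ball_cover.
have [m mP] := choice ex.
have mI i : measurable (I i : set X).
  by apply: is_interval_measurable; exact: ibI.1.
have mbI : measurable (tuple_box I) by exact: measurable_tuple_box.
pose Q : set (n.-tuple X) := tuple_box (fun i => rat_ball (m i)).
have mQ : measurable Q.
  by apply: measurable_tuple_box => i; exact: measurable_rat_ball.
have IQ : tuple_box I `<=` Q.
  move=> y Iy i; have [_ _ /(_ _ (Iy i)) ? _] := sides i.
  by apply: (mP i).1.
have L0 i : 0 < L i by have [] := sides i.
rewrite vL /= (_ : box I = tuple_box I)//.
have -> : (\int[@volume R n]_(y in tuple_box I) `|f y|%:E =
           \int[borel_volume R n]_(y in tuple_box I) (EFin \o g) y)%E.
  have mF : measurable_fun [set: euclidean R n] (fun y => `|f y|%:E).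
    by apply/measurable_EFinP; exact: measurableT_comp.
  have F0 (y : euclidean R n) : (0 <= `|f y|%:E)%E by rewrite lee_fin.
  have Fg (y : euclidean R n) : ~ N y -> `|f y|%:E = (EFin \o g) y.
    by move=> Ny; rewrite /= fg.
  exact: (volume_integral_modification mbI mF F0 mEg Eg0 mN N0 Fg).
have P0 : 0 < \prod_(i < n) L i by apply: prodr_gt0.
rewrite lee_pdivrMl//.
apply: (@le_trans _ _ (\int[borel_volume R n]_(y in Q) (EFin \o g) y)%E).
  by apply: ge0_subset_integral => //; exact: measurable_funTS.
apply: (le_trans (integral_rat_box_le mEg Eg0 _)); first exact: (IQ _ Ax).
rewrite muleA -EFinM lee_wpmul2r ?iter_maximal_ge0//.
rewrite lee_fin mulrC.
have -> : 2 ^+ n = \prod_(i < n) (2 : R) by rewrite prodr_const card_ord.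
rewrite -big_split/=; apply: ler_prod => i _.
have r0 := rat_radius_gt0 R (m i).
rewrite mulr_ge0// ?(ltW r0)//= ler_pM2l//.
exact: (mP i).2.
Qed.

Lemma rare_basis_weak_type n (B : set (set (euclidean R n))) :
  (0 < n)%N -> rare_basis B ->
  exists C : R, weak_type B (fun u => u * (1 + log2p u) ^+ n.-1) C.
Proof.
move=> n0 rB.
pose K : R := 2 * 4 ^+ n * (1 + (2 * n)%:R) ^+ n.-1.
have K0 : 0 <= K by rewrite mulr_ge0 ?exprn_ge0// mulr_ge0// exprn_ge0.
exists (6 ^+ n * K) => f mf a a0.
have mabs : measurable_fun setT (fun x => `|f x|) by exact: measurableT_comp.
have [g [mg g0 [N [mN N0 fg]]]] := borel_modification mabs (fun x => normr_ge0 _).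
have mEg : measurable_fun setT (EFin \o g) by exact/measurable_EFinP.
have Eg0 y : (0 <= (EFin \o g) y)%E by rewrite lee_fin.
(* One factor [2 ^+ n] comes from [maximal_operator_le], the other one from
   [iter_maximal_weak]. *)
pose b := a / 4 ^+ n.
have b0 : 0 < b by rewrite divr_gt0// exprn_gt0.
have four_pow : 4 ^+ n = 2 ^+ n * 2 ^+ n :> R by rewrite -exprMn -natrM.
have ab : a = 2 ^+ n * (2 ^+ n * b).
  have z0 : 2 ^+ n != 0 :> R by rewrite expf_neq0.
  by rewrite /b four_pow; field.
set E := [set x | (2 ^+ n * b)%:E < iter_maximal (EFin \o g) x]%E.
have mE : measurable E.
  rewrite -[E]setTI; apply: emeasurable_fun_o_infty => //.
  exact: measurable_iter_maximal.
apply: (@le_trans _ _ (volume E)).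
  apply: le_volume => x /= ax.
  have := lt_le_trans ax (maximal_operator_le x rB mf mg g0 mN N0 fg).
  by rewrite ab EFinM lte_pmul2l// lte_fin exprn_gt0.
rewrite volume_borel//.
apply: (le_trans (iter_maximal_weak mg g0 b0)).
pose Phi (u : R) := u * (1 + log2p u) ^+ n.-1.
have Phi0 u : 0 <= u -> 0 <= Phi u.
  by move=> u0; rewrite mulr_ge0// exprn_ge0// addr_ge0// log2p_ge0.
have mPhig : measurable_fun setT (fun x => (Phi (g x / a))%:E).
  apply/measurable_EFinP; apply: (measurableT_comp (@measurable_log_gauge n.-1)).
  exact: measurable_funM.
have ga0 x : 0 <= g x / a by rewrite divr_ge0// ltW.
have -> : (\int[@volume R n]_x (Phi (`|f x| / a))%:E =
           \int[borel_volume R n]_x (Phi (g x / a))%:E)%E.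
  have mF : measurable_fun [set: euclidean R n] (fun x => (Phi (`|f x| / a))%:E).
    apply/measurable_EFinP; apply: (measurableT_comp (@measurable_log_gauge n.-1)).
    exact: measurable_funM.
  have F0 (x : euclidean R n) : (0 <= (Phi (`|f x| / a))%:E)%E.
    by rewrite lee_fin Phi0// divr_ge0// ltW.
  have G0 x : (0 <= (Phi (g x / a))%:E)%E by rewrite lee_fin Phi0.
  have Fg (y : euclidean R n) : ~ N y -> (Phi (`|f y| / a))%:E = (Phi (g y / a))%:E.
    by move=> Ny; rewrite fg.
  exact: (volume_integral_modification measurableT mF F0 mPhig G0 mN N0 Fg).
rewrite EFinM -muleA lee_wpmul2l// ?lee_fin ?exprn_ge0//.
rewrite -ge0_integralZl//; last by move=> x _; rewrite lee_fin Phi0.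
apply: ge0_le_integral => //.
- by move=> x _; exact: layer_gauge_ge0.
- exact: measurable_layer_gauge_comp.
- exact: measurable_funeM.
move=> x _; have := ga0 x; set u := g x / a => u0.
have -> : g x / b = 2 ^+ (2 * n) * u.
  rewrite /b /u four_pow mul2n -addnn exprD.
  have z0 : 2 ^+ n != 0 :> R by rewrite expf_neq0.
  by field; rewrite z0 gt_eqF.
rewrite -{1}(prednK n0).
have c0 : 0 < 2 ^+ (2 * n) :> R by rewrite exprn_gt0.
apply: (le_trans (layer_gauge_le _ _)); first by rewrite mulr_ge0// ltW.
rewrite -EFinM lee_fin /K /Phi.
have -> : 4 ^+ n = 2 ^+ (2 * n) :> R by rewrite four_pow mul2n -addnn exprD.
have l0 := log2p_ge0 u.
have step : (1 + log2p (2 ^+ (2 * n) * u)) ^+ n.-1 <=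
            (1 + (2 * n)%:R) ^+ n.-1 * (1 + log2p u) ^+ n.-1.
  rewrite -exprMn lerXn2r ?nnegrE ?mulr_ge0 ?addr_ge0 ?log2p_ge0//.
  have := log2p_mul_pow2 (2 * n) u0.
  have : 0 <= (2 * n)%:R * log2p u by rewrite mulr_ge0.
  by rewrite mulrDl mul1r mulrDr mulr1; lra.
have c1 : 0 <= 2 * (2 ^+ (2 * n) * u).
  by apply: mulr_ge0 => //; apply: mulr_ge0 => //; exact: ltW.
apply: (le_trans (ler_wpM2l c1 step)).
move: ((1 + (2 * n)%:R) ^+ n.-1) ((1 + log2p u) ^+ n.-1) (2 ^+ (2 * n)) => p q r.
by rewrite le_eqVlt; apply/orP; left; apply/eqP; ring.
Qed.

End strong_maximal_weak_type.

(** * Nested periodic sets on the line *)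

Section periodic_copies.
Context (R : realType).
Local Notation leb := (@lebesgue_measure R).
Local Notation X := (measurableTypeR R).
Implicit Types (A : set R) (p c : R) (q : nat).

Definition shift_set c A : set R := [set x : R | A (x - c)].

Lemma measurable_shift c : measurable_fun setT (fun x : X => x - c : X).
Proof. exact: measurable_funB. Qed.

Lemma measurable_shift_set c A :
  measurable (A : set X) -> measurable (shift_set c A : set X).
Proof. by move=> mA; rewrite -[X in measurable X]setTI; exact: measurable_shift. Qed.

Lemma lebesgue_shift_set c A : measurable (A : set X) -> leb (shift_set c A) = leb A.
Proof.
move=> mA; rewrite [RHS](@lebesgue_measure_unique R
  (pushforward leb (fun x : X => x - c : X)))//.
  exact: measurable_shift.
move=> mc _ [[u v] _ <-]; rewrite /pushforward.
rewrite [X in _ = leb X](_ : _ = `](u + c), (v + c)]%classic); last first.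
  by apply/seteqP; split => x /=; rewrite !in_itv/= ltrBrDr lerBlDr.
by rewrite !lebesgue_measure_itv/= !lte_fin ltrD2r -!EFinB opprD addrACA subrr addr0.
Qed.

Definition copies q p A : set R := \bigcup_(j < q) shift_set (j%:R * p) A.

Lemma measurable_copies q p A :
  measurable (A : set X) -> measurable (copies q p A : set X).
Proof. by move=> mA; apply: bigcup_measurable => j _; exact: measurable_shift_set. Qed.

Lemma copies_sub q p A : 0 < p -> A `<=` `]0, p[ -> copies q p A `<=` `]0, q%:R * p[.
Proof.
move=> p0 Ap x [j /= jq /Ap] /=; rewrite !in_itv/= subr_gt0 => /andP[jx xj].
rewrite (le_lt_trans _ jx) ?mulr_ge0 ?(ltW p0)//=.
rewrite ltrBlDr in xj; apply: (lt_le_trans xj).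
by rewrite -[X in X + _]mul1r -mulrDl ler_pM2r// nat1r ler_nat.
Qed.

Lemma copiesS q p A A' : A `<=` A' -> copies q p A `<=` copies q p A'.
Proof. by move=> AA x [j jq /AA Ax]; exists j. Qed.

Lemma lebesgue_copies q p A m : 0 < p -> measurable (A : set X) -> A `<=` `]0, p[ ->
  leb A = m%:E -> leb (copies q p A) = (q%:R * m)%:E.
Proof.
move=> p0 mA Ap Am; rewrite /copies measure_fin_bigcup//=.
- rewrite -(@fsbig_ord _ _ _ q (fun j => leb (shift_set (j%:R * p) A))).
  under eq_bigr do rewrite lebesgue_shift_set// Am.
  by rewrite sumEFin sumr_const card_ord mulr_natl.
- apply/trivIsetP => i j _ _ ij; rewrite -subset0 => x [/Ap + /Ap].
  rewrite /= !in_itv /= => /andP[xi0 xi] /andP[xj0 xj].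
  wlog ltij : i j ij xi0 xi xj0 xj / (i < j)%N.
    move=> W; move: (ij); rewrite neq_ltn => /orP[ltij|ltji].
      exact: (W i j).
    by apply: (W j i) => //; rewrite eq_sym.
  have : j%:R * p < i.+1%:R * p.
    by rewrite -natr1 mulrDl mul1r; move: (x : R) {xi0 xj} xi xj0 => {}x; lra.
  by rewrite ltr_pM2r// ltr_nat ltnS leqNgt ltij.
- by move=> j _; exact: measurable_shift_set.
Qed.

(** Induction on [k]: the sets for [k + 1] are [q] consecutive copies, with period
    [2 * l k], of those for [k], together with the union of the open periods as the
    new largest set. The previous largest set fills half of each period, so that the
    measures keep doubling. A point of an old set finds its interval inside its own
    copy. For a point of the largest set, an interval of length [L] between one period and the whole
    block contains at least [L / (2 p)] full periods, where [p] is the period, and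
    [F 0] has density [2 ^- (k + 1)] in each of them. *)
Lemma nested_towers (k : nat) (l : nat -> R) :
  (forall a, 0 < l a) ->
  (forall a, (a < k)%N -> exists2 q : nat, (0 < q)%N & l a.+1 = q%:R * (2 * l a)) ->
  exists F : nat -> set R,
    [/\ forall a, (a <= k)%N -> [/\ measurable (F a : set X), F a `<=` `]0, l k[ &
          leb (F a) = (2 ^+ a * (l k / 2 ^+ k))%:E],
        forall a, (a < k)%N -> F a `<=` F a.+1 &
        forall a x (L : R), (a <= k)%N -> F a x ->
          ((0 < a)%N -> 2 * l a.-1 <= L) -> 0 < L <= l a ->
          exists c : R, c < x < c + L /\
            ((2 ^- a * (L / 2))%:E <= leb (F 0%N `&` `]c, (c + L)%R[))%E].
Proof.
move=> l0; elim: k => [|k IH] lq.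
  exists (fun=> `]0, l 0[%classic); split => // [[] // _|a x L].
    split => //.
    by rewrite lebesgue_measure_itv/= lte_fin l0 -EFinB subr0 !expr0 divr1 mul1r.
  rewrite leqn0 => /eqP -> /=; rewrite in_itv/= => /andP[x0 xl] _ /andP[L0 Ll].
  (* The interval starts at [x - L * t], where [t] is the relative position of [x]
     in the block, so that it stays inside the block. *)
  set t := x / l 0%N.
  have t0 : 0 < t by rewrite divr_gt0.
  have t1 : t < 1 by rewrite ltr_pdivrMr ?mul1r.
  have xt : x = t * l 0%N by rewrite /t divfK// gt_eqF.
  have Lt : 0 < L * t by rewrite mulr_gt0.
  have Lt1 : 0 < L * (1 - t) by rewrite mulr_gt0// subr_gt0.
  exists (x - L * t); split; first by apply/andP; split; lra.
  rewrite expr0 invr1 mul1r (_ : _ `&` _ = `](x - L * t), (x - L * t + L)[%classic).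
    by rewrite lebesgue_measure_itv/= lte_fin ltrDl L0 -EFinB lee_fin; lra.
  have c0 : 0 <= x - L * t by rewrite xt [L * t]mulrC -mulrBr mulr_ge0 ?subr_ge0// ltW.
  have cl : x - L * t + L <= l 0%N.
    have : 0 <= (l 0%N - L) * (1 - t) by rewrite mulr_ge0// subr_ge0// ltW.
    rewrite xt; lra.
  apply/seteqP; split => [y []//|y yc]; split => //; move: yc.
  by rewrite /= !in_itv/= => /andP[y1 y2]; apply/andP; split; lra.
have [q q0 lk] := lq k (ltnSn k).
have [a ak|F' [F'1 F'2 F'3]] := IH; first by apply: lq; rewrite ltnS ltnW.
set p := 2 * l k in lk.
have p0 : 0 < p by rewrite mulr_gt0.
have lkp : l k < p by rewrite /p mulr_natl mulr2n ltrDl.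
have F'p a : (a <= k)%N -> F' a `<=` `]0, p[.
  move=> /F'1[_ sub _] x /sub /=; rewrite !in_itv/= => /andP[-> /=] /lt_trans; exact.
have mp : measurable (`]0, p[%classic : set X) by exact: measurable_itv.
have lebp : leb `]0, p[%classic = p%:E.
  by rewrite lebesgue_measure_itv/= lte_fin p0 -EFinB subr0.
pose F a := if (a <= k)%N then copies q p (F' a) else copies q p `]0, p[%classic.
have Fk a : (a <= k)%N -> F a = copies q p (F' a) by rewrite /F => ->.
exists F; split.
- move=> a; rewrite leq_eqVlt => /predU1P[->|].
    rewrite /F ltnn; split; first exact: measurable_copies.
    - by rewrite lk; exact: copies_sub.
    - by rewrite (lebesgue_copies q p0 mp _ lebp)// -lk mulrC mulfVK// expf_neq0.
  rewrite ltnS => ak; have [mF sF lF] := F'1 a ak; rewrite Fk//; split.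
  + exact: measurable_copies.
  + by rewrite lk; apply: copies_sub => //; exact: F'p.
  + rewrite (lebesgue_copies q p0 mF (F'p _ ak) lF); congr EFin.
    by rewrite lk /p exprS; field; rewrite expf_neq0.
- move=> a; rewrite ltnS leq_eqVlt => /predU1P[->|ak].
    by rewrite Fk// /F ltnn; apply: copiesS; exact: F'p.
  by rewrite !Fk// 1?ltnW//; apply: copiesS; exact: F'2.
move=> a x L; rewrite leq_eqVlt => /predU1P[->|]; last first.
  rewrite ltnS => ak; rewrite (Fk _ ak) => -[j /= jq F'x] La Ll.
  have [c [/andP[cx xc] H]] := F'3 a _ L ak F'x La Ll.
  exists (c + j%:R * p); split; first by apply/andP; split; lra.
  apply: (le_trans H); rewrite -(@lebesgue_shift_set (j%:R * p)); last first.
    apply: measurableI; last exact: measurable_itv.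
    by have [] := F'1 0%N isT.
  rewrite Fk//; apply: le_outer_measure => y [Fy] /=; rewrite !in_itv/= => cy.
  by split; [exists j|lra].
rewrite /F ltnn => -[j /= jq]; rewrite /shift_set /= in_itv/= => /andP[jx xj].
move=> /(_ isT) pL /andP[L0 Ll].
rewrite -/p in pL.
pose m := Num.truncn (L / p).
have [mL Lm] : m%:R * p <= L /\ L < m.+1%:R * p.
  have Lp0 : 0 <= L / p by apply: divr_ge0; apply: ltW.
  have /andP[] := truncn_itv Lp0.
  by rewrite ler_pdivlMr// ltr_pdivrMr.
have m0 : (0 < m)%N.
  rewrite lt0n; apply/eqP => m0; move: Lm; rewrite m0 mul1r; lra.
have L2m : L <= 2 * (m%:R * p).
  have : 1 <= m%:R :> R by rewrite ler1n.
  move: Lm; rewrite -natr1 mulrDl mul1r => Lm m1.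
  have : p <= m%:R * p by rewrite ler_peMl// ltW.
  lra.
(* The interval starts with the period of [x], or ends with the block when the first
   choice would leave it; either way it contains [m] full periods. *)
have [i [c [imq ci ic cx]]] : exists i c, [/\ (i + m <= q)%N, c <= i%:R * p,
    (i + m)%:R * p <= c + L & c < x < c + L].
  have [jL|jL] := leP (j%:R * p + L) (l k.+1).
    exists j, (j%:R * p); split => //.
    - rewrite -(ler_nat R) -(ler_pM2r p0) -lk natrD mulrDl; lra.
    - rewrite natrD mulrDl; lra.
    - by apply/andP; split; lra.
  have mq : (m <= q)%N.
    by rewrite -(ler_nat R) -(ler_pM2r p0) -lk; lra.
  exists (q - m)%N, (l k.+1 - L); split => //.
  - by rewrite subnK.
  - rewrite natrB// mulrBl -lk; lra.
  - rewrite subnK// -lk; lra.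
  - have : (j.+1%:R * p <= q%:R * p) by rewrite ler_pM2r// ler_nat.
    rewrite -lk -natr1 mulrDl mul1r => jk.
    by apply/andP; split; lra.
exists c; split=> //.
have [mF0 sF0 lF0] := F'1 0%N isT.
apply: (@le_trans _ _ (leb (shift_set (i%:R * p) (copies m p (F' 0%N))))).
  rewrite lebesgue_shift_set; last exact: measurable_copies.
  rewrite (lebesgue_copies m p0 mF0 (F'p 0%N isT) lF0) lee_fin.
  rewrite expr0 mul1r exprS invfM.
  have k0 : 0 <= 2 ^- k :> R by rewrite invr_ge0 exprn_ge0.
  have := ler_wpM2r k0 L2m; rewrite /p; move: (2 ^- k) => z Lz; lra.
apply: le_outer_measure => y [t /= tm F0y].
have := F'p 0%N isT _ F0y; rewrite /= in_itv/= => /andP[y1 y2].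
split.
  exists (i + t)%N => /=; first by rewrite (leq_trans _ imq)// ltn_add2l.
  by rewrite /shift_set /= natrD mulrDl opprD addrA.
rewrite /= in_itv/=.
have : (t.+1%:R * p <= m%:R * p) by rewrite ler_pM2r// ler_nat.
rewrite -natr1 mulrDl mul1r => tp.
have t0 : 0 <= t%:R * p by rewrite mulr_ge0// ltW.
rewrite natrD mulrDl in ic.
by apply/andP; split; lra.
Qed.

End periodic_copies.

(** * Separated scales in the spectrum *)

Section spectrum_selection.

Lemma infinite_int_unbounded (S : set int) : infinite_set S ->
  (forall M, exists2 s, S s & M <= s) \/ (forall M, exists2 s, S s & s <= M).
Proof.
move=> Sinf; apply: contrapT => /not_orP[/existsNP[M1 H1] /existsNP[M2 H2]].
apply: Sinf; apply: (@sub_finite_set _ _ ((fun j : nat => M2 + j%:Z) @` `I_(`|M1 - M2|%N))).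
  move=> s Ss; have sM1 : s < M1 by rewrite ltNge; apply/negP => ?; apply: H1; exists s.
  have sM2 : M2 < s by rewrite ltNge; apply/negP => ?; apply: H2; exists s.
  by exists `|s - M2|%N => /=; lia.
by apply: finite_image; exact: finite_II.
Qed.

(** An infinite set of integers is unbounded on one side; the chain is extended at
    its top or at its bottom accordingly. *)
Lemma separated_chain (S : set int) (G : int) (k : nat) : infinite_set S ->
  exists sigma : nat -> int, (forall a, (a <= k)%N -> S (sigma a)) /\
    (forall a, (a < k)%N -> sigma a + G <= sigma a.+1).
Proof.
move=> /infinite_int_unbounded[] unb; elim: k => [|k [sigma [Ss gap]]].
- by have [s Ss _] := unb 0; exists (fun=> s).
- have [s Ss' sG] := unb (sigma k + G).
  exists (fun a => if (a <= k)%N then sigma a else s); split=> a.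
    by case: (leqP a k) => [ak _|//]; exact: Ss.
  rewrite ltnS => ak; rewrite ak; case: (leqP a.+1 k) => [/gap//|].
  by rewrite ltnS => ka; rewrite (_ : a = k)//; lia.
- by have [s Ss _] := unb 0; exists (fun=> s).
- have [s Ss' sG] := unb (sigma 0%N - G).
  exists (fun a => if a is b.+1 then sigma b else s); split=> -[|a] ak //=.
  + exact: Ss.
  + lia.
  + exact: gap.
Qed.

Lemma prefix_proj_rcons m (t : m.-tuple int) (x : int) :
  prefix_proj m [tuple of rcons t x] = t.
Proof.
apply: eq_from_tnth => i; rewrite tnth_mktuple /= nth_rcons size_tuple ltn_ord.
by rewrite (tnth_nth 0).
Qed.

(** The net constants depend on the preceding coordinates. At the step that handles
    coordinate [m], only the finitely many points of the projected spectrum chosen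
    for the functions from ['I_m] to ['I_k.+1] occur; [N m] is the largest of their
    constants, and only then are the values [sigma m] taken in [S m], with gaps that
    exceed [2 * N m]. *)
Lemma dense_in_tree n (W : set (n.-tuple int)) (S : 'I_n -> set int) (k : nat) :
  (0 < n)%N -> (forall i, infinite_set (S i)) -> dense_in W S ->
  exists (sigma : nat -> nat -> int) (N : nat -> nat),
    (forall i a, (i < n)%N -> (a < k)%N ->
       sigma i a + (2 * N i + 2)%N%:Z <= sigma i a.+1) /\
    forall a : nat -> nat, (forall i, (i < n)%N -> (a i <= k)%N) ->
      exists2 w, W w & forall i : 'I_n, `|tnth w i - sigma i (a i)| <= (N i)%:Z.
Proof.
move=> n0 Sinf dW.
suff /(_ n (leqnn n)) [sigma [N [gap H]]] : forall m, (m <= n)%N ->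
    exists (sigma : nat -> nat -> int) (N : nat -> nat),
    (forall i a, (i < m)%N -> (a < k)%N ->
       sigma i a + (2 * N i + 2)%N%:Z <= sigma i a.+1) /\
    forall a : nat -> nat, (forall i, (i < m)%N -> (a i <= k)%N) ->
      exists t : m.-tuple int, ((0 < m)%N -> (@prefix_proj n m @` W) t) /\
        forall i, (i < m)%N -> `|nth 0 t i - sigma i (a i)| <= (N i)%:Z.
  exists sigma, N; split => // a /H[t [/(_ n0)[w Ww wt] tP]].
  exists w => // i; have := tP i (ltn_ord i); rewrite -wt.
  by rewrite -(tnth_nth 0 (prefix_proj n w) i) tnth_mktuple -tnth_nth.
elim=> [|m IH] mn.
  by exists (fun _ _ => 0), (fun=> 0%N); split => // a _; exists [tuple].
have [sigma [N [gap H]]] := IH (ltnW mn).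
pose im := Ordinal mn.
have selt (phi : {ffun 'I_m -> 'I_k.+1}) : exists t : m.-tuple int,
    ((0 < m)%N -> (@prefix_proj n m @` W) t) /\
    forall i : 'I_m, `|nth 0 t i - sigma i (phi i)| <= (N i)%:Z.
  have [|t [tW tP]] := H (fun i => if insub i is Some j then phi j : nat else 0%N).
    by move=> i _; case: insubP => // j _ _; rewrite -ltnS.
  by exists t; split => // i; have := tP i (ltn_ord i); rewrite valK.
have [tt ttP] := choice selt.
have selN phi := dW im (tt phi).
have [Nf NfP] := choice selN.
pose Nm := (\max_phi Nf phi)%N.
have [sm [smS smgap]] := separated_chain (2 * Nm + 2)%N%:Z k (Sinf im).
exists (fun i => if i == m then sm else sigma i), (fun i => if i == m then Nm else N i).
split=> [i a|a aP].
  rewrite ltnS leq_eqVlt => /predU1P[->|im'] ak; first by rewrite eqxx smgap.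
  by rewrite (ltn_eqF im') gap.
pose phi : {ffun 'I_m -> 'I_k.+1} := [ffun i : 'I_m => inord (a i)].
have phiE (i : 'I_m) : phi i = a i :> nat.
  by rewrite ffunE inordK// ltnS aP// ltnW// ltnS ltn_ord.
have [ttW ttN] := ttP phi.
have [|tau tauW tauN] := NfP phi (sm (a m)).
  split => /=; last first.
    by rewrite (tnth_nth 0)/= nth_rcons size_tuple ltnn eqxx; apply: smS; exact: aP.
  by move=> m0; rewrite prefix_proj_rcons; exact: ttW.
exists [tuple of rcons (tt phi) tau]; split=> [_ //|i].
rewrite ltnS leq_eqVlt => /predU1P[->|im'] /=; rewrite nth_rcons size_tuple.
  rewrite ltnn eqxx distrC (le_trans tauN)// lez_nat.
  exact: (leq_bigmax (F := Nf) phi).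
by rewrite im' (ltn_eqF im') -[a i](phiE (Ordinal im')); exact: (ttN (Ordinal im')).
Qed.

End spectrum_selection.

(** * Lower bound for the maximal operator *)

Section translated_boxes.
Context (R : realType).
Local Notation leb := (@lebesgue_measure R).
Local Notation X := (measurableTypeR R).

Lemma translate_box n (v : euclidean R n) (I : 'I_n -> set R) :
  translate v (box I) = box (fun i => shift_set (component v i) (I i)).
Proof.
apply/seteqP; split => [_ [x Ix <-] i|y Iy].
  by rewrite /shift_set /= /component tnth_mktuple addrK; exact: Ix.
exists [tuple component y i - component v i | i < n].
  by move=> i; rewrite /component tnth_mktuple; exact: Iy.
by apply: eq_from_tnth => i; rewrite !tnth_mktuple /component tnth_mktuple subrK.
Qed.

Lemma prod_le_ereal n (d : 'I_n -> R) (u : 'I_n -> \bar R) :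
  (forall i, 0 <= d i) -> (forall i, ((d i)%:E <= u i)%E) ->
  ((\prod_(i < n) d i)%:E <= \prod_(i < n) u i)%E.
Proof.
move=> d0 du; rewrite -prodEFin.
elim: n d u d0 du => [|n IH] d u d0 du; first by rewrite !big_ord0.
rewrite !big_ord_recl; apply: lee_pmul => //; first by rewrite lee_fin.
  by rewrite prodEFin lee_fin prodr_ge0.
exact: IH.
Qed.

(** Translation invariance lets the interval [box I] of the basis be moved so that
    its [i]-th side starts at [c i]. *)
Lemma maximal_operator_box_ge n (B : set (set (euclidean R n)))
    (I : 'I_n -> set R) (c L d : 'I_n -> R) (Es : 'I_n -> set R) (x : n.-tuple X) :
  rare_basis B -> interval_box I -> B (box I) ->
  (forall i, leb (I i) = (L i)%:E) ->
  (forall i, measurable (Es i : set X)) ->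
  (forall i, c i < tnth x i < c i + L i) ->
  (forall i, 0 <= d i) ->
  (forall i, ((d i * L i)%:E <= leb (Es i `&` `]c i, (c i + L i)%R[))%E) ->
  ((\prod_(i < n) d i)%:E <= maximal_operator B (\1_(box Es)) x)%E.
Proof.
move=> rB ibI BI lI mE cx d0 dE.
have [_ _ Btr] := rB.
have [e [L' [_ sides]]] := interval_box_sides ibI.
have LE i : L' i = L i by have [_ _ _] := sides i; rewrite lI => -[].
have mI i : measurable (I i : set X) by apply: is_interval_measurable; exact: ibI.1.
pose v : euclidean R n := [tuple c i - e i | i < n].
pose J i := shift_set (c i - e i) (I i).
have BJ : B (box J).
  have := Btr v _ BI; rewrite translate_box.
  by under eq_fun do rewrite /component tnth_mktuple.
have mJ i : measurable (J i : set X) by exact: measurable_shift_set.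
have lJ i : leb (J i) = (L i)%:E by rewrite lebesgue_shift_set.
have L0 i : 0 < L i by rewrite -LE; have [] := sides i.
have sJ i : `]c i, c i + L i[ `<=` J i.
  move=> y; rewrite /= in_itv/= => cy; have [_ sI _ _] := sides i.
  by apply: sI; rewrite /= in_itv/= LE; move: cy => /andP[? ?]; apply/andP; split; lra.
have Jx : box J x by move=> i; apply: sJ; rewrite /= in_itv/=; exact: cx.
have mbJ : measurable (tuple_box J) by exact: measurable_tuple_box.
have mbE : measurable (tuple_box Es) by exact: measurable_tuple_box.
have vJ : volume (box J) = (\prod_(i < n) L i)%:E.
  rewrite (_ : box J = tuple_box J)// volume_borel// borel_volume_box//.
  by rewrite -prodEFin; apply: eq_bigr => i _.
apply: (le_trans _ (ereal_sup_ubound _)); last by exists (box J); split.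
have P0 : 0 < \prod_(i < n) L i by apply: prodr_gt0.
rewrite vJ /= lee_pdivlMl//.
have -> : (\int[@volume R n]_(y in box J) `|\1_(box Es) y|%:E)%E =
    volume (box Es `&` box J).
  rewrite (eq_integral (fun y => (\1_(box Es) y)%:E)); last first.
    by move=> y _; rewrite ger0_norm// indicE ler0n.
  by rewrite integral_indic//; exact: borel_lebesgue.
rewrite (_ : _ `&` _ = tuple_box (fun i => Es i `&` J i)); last first.
  apply/seteqP; split => y; last by move=> EJ; split=> i; have [] := EJ i.
  by move=> [Ey Jy] i; split; [exact: Ey|exact: Jy].
rewrite volume_borel; last by apply: measurable_tuple_box => i; exact: measurableI.
rewrite borel_volume_box; last by move=> i; exact: measurableI.
rewrite -EFinM mulrC -big_split/=; apply: prod_le_ereal => i.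
  by rewrite mulr_ge0// ltW.
apply: (le_trans (dE i)); apply: le_outer_measure => y [Ey cy]; split => //.
exact: sJ.
Qed.

End translated_boxes.

Section annuli.
Context (R : realType).
Local Notation leb := (@lebesgue_measure R).
Local Notation X := (measurableTypeR R).
Variables (k : nat) (F : nat -> set R) (mu : R).
Hypothesis mF : forall a, (a <= k)%N -> measurable (F a : set X).
Hypothesis lF : forall a, (a <= k)%N -> leb (F a) = (2 ^+ a * mu)%:E.
Hypothesis sF : forall a, (a < k)%N -> F a `<=` F a.+1.
Hypothesis mu0 : 0 <= mu.

Definition annulus a : set R := if a is b.+1 then F a `\` F b else F 0%N.

Lemma annulus_sub a : annulus a `<=` F a.
Proof. by case: a => //= a; exact: subDsetl. Qed.

Lemma measurable_annulus a : (a <= k)%N -> measurable (annulus a : set X).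
Proof.
case: a => [|a] ak /=; first exact: mF.
by apply: measurableD; apply: mF => //; exact: ltnW.
Qed.

Lemma annulus_measure a : (a <= k)%N ->
  ((2 ^+ a * mu / 2)%:E <= leb (annulus a))%E.
Proof.
case: a => [|a] ak /=.
  rewrite lF// lee_fin expr0; have := mu0; lra.
have mFa : measurable (F a : set X) by apply: mF; exact: ltnW.
have Foo : (leb (F a.+1) < +oo)%E by rewrite lF// ltry.
rewrite (measureD (mF ak) mFa Foo) setIidr; last exact: sF.
rewrite [X in (_ <= X - _)%E](lF ak) [X in (_ - X)%E](lF (ltnW ak)).
by rewrite -EFinB lee_fin exprS; have := mu0; lra.
Qed.

Lemma nested_le a b : (a <= b)%N -> (b <= k)%N -> F a `<=` F b.
Proof.
elim: b => [|b IH]; first by rewrite leqn0 => /eqP -> _ x.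
rewrite leq_eqVlt => /predU1P[-> _ x //|]; rewrite ltnS => ab bk.
by apply: (subset_trans (IH ab (ltnW bk))); exact: sF.
Qed.

Lemma annulus_disj a b x : (a <= k)%N -> (b <= k)%N ->
  annulus a x -> annulus b x -> a = b.
Proof.
wlog : a b / (a <= b)%N.
  by move=> W ak bk xa xb; case: (leqP a b) => [ab|/ltnW ab]; [exact: W|symmetry; exact: W].
rewrite leq_eqVlt => /predU1P[//|]; case: b => // b; rewrite ltnS => ab ak bk xa [_ nb].
by case: nb; apply: (nested_le ab (ltnW bk)); exact: annulus_sub.
Qed.

End annuli.

Section lower_bound.
Context (R : realType).
Local Notation leb := (@lebesgue_measure R).
Local Notation X := (measurableTypeR R).

Lemma log2_exprz (z : int) : log2 ((2 : R) ^ z) = z%:~R.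
Proof.
case: z => j; first by rewrite -exprnP log2_pow2.
rewrite NegzE -exprnN /log2 lnV ?posrE ?exprn_gt0// mulNr -/(log2 _) log2_pow2.
by rewrite mulrNz.
Qed.

Lemma ceil_log2 (L : R) : 0 < L ->
  2 ^ (Num.ceil (log2 L) - 1) < L <= 2 ^ (Num.ceil (log2 L)).
Proof.
move=> L0; have ln20 : 0 < ln 2 :> R by rewrite ln_gt0// ltr1n.
have P z : 0 < (2 : R) ^ z by rewrite exprz_gt0.
have lt_log (u v : R) : 0 < u -> 0 < v -> (log2 u < log2 v) = (u < v).
  by move=> u0 v0; rewrite /log2 ltr_pM2r ?invr_gt0// ltr_ln// posrE.
apply/andP; split; first by rewrite -lt_log// log2_exprz real_ceilB1_lt ?num_real.
by rewrite leNgt -lt_log// log2_exprz -leNgt real_ceil_ge ?num_real.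
Qed.

Lemma double_exprz (z : int) : (2 : R) ^ (1 + z) = 2 * 2 ^ z.
Proof. by rewrite expfzDr// expr1z. Qed.

(** A length recorded in the spectrum within [N] of [sigma] lies in the window
    between twice [2 ^ (sigma' + N)] and [2 ^ (sigma + N)], as soon as the gap from
    [sigma'] to [sigma] is at least [2 * N + 2]. *)
Lemma scale_of_spectrum (sigma N w sigma' : int) (L : R) :
  0 < L -> w = Num.ceil (log2 L) -> `|w - sigma| <= N ->
  L <= 2 ^ (sigma + N) /\
  (sigma' + (2 * N + 2) <= sigma -> 2 * 2 ^ (sigma' + N) <= L).
Proof.
move=> L0 wL wN; have := ceil_log2 L0; rewrite -wL => /andP[Lw wL'].
have mono := @ler_eXz2l R 2 (ltr1n _ 2).
split; first by apply: (le_trans wL'); rewrite mono; lia.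
move=> gap; apply: le_trans (ltW Lw).
by rewrite -double_exprz mono; lia.
Qed.

Lemma scale_ratio (sigma sigma' N : int) : sigma' + 1 <= sigma ->
  exists2 q : nat, (0 < q)%N & (2 : R) ^ (sigma + N) = q%:R * (2 * 2 ^ (sigma' + N)).
Proof.
move=> gap; exists (2 ^ absz (sigma - sigma' - 1)%R)%N; first by rewrite expn_gt0.
rewrite natrX exprnP gez0_abs; last by lia.
rewrite -(double_exprz _) -expfzDr//; congr (_ ^ _); lia.
Qed.

(** With [l i a = 2 ^ (sigma i a + N i)] as block lengths, every point of the product
    of the sets [F i (a i)] lies in an interval of the basis where [E] has density at
    least the product of the [2 ^- (a i) / 2]. The sum of the [a i] is kept equal to
    [k] by letting [a 0] compensate for the others, which range freely over
    [0, ..., k / n]; this already gives the right order [k ^ (n - 1)] for the number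
    of products. *)
Lemma lower_bound_dyadic m (B : set (set (euclidean R m.+1))) (k : nat) :
  rare_basis B ->
  (exists2 S : 'I_m.+1 -> set int,
     forall i, infinite_set (S i) & dense_in (spectrum B) S) ->
  exists E : set (euclidean R m.+1),
    [/\ measurable E, bounded_subset E, (0 < volume E < +oo)%E &
      forall alpha : R, alpha < 2 ^- (k + m.+1) ->
        ((2 ^+ k / 2 ^+ m * ((k %/ m.+1).+1%:R) ^+ m)%:E * volume E <=
         volume [set x | (alpha%:E < maximal_operator B (\1_E) x)%E])%E].
Proof.
move=> rB [S Sinf /(dense_in_tree k (ltn0Sn m) Sinf)[sigma [N [gap sel]]]].
pose l (i : 'I_m.+1) a : R := 2 ^ (sigma i a + (N i)%:Z).
have l0 i a : 0 < l i a by rewrite exprz_gt0.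
have ratio (i : 'I_m.+1) a : (a < k)%N ->
    exists2 q : nat, (0 < q)%N & l i a.+1 = q%:R * (2 * l i a).
  by move=> ak; apply: scale_ratio; have := gap i a (ltn_ord i) ak; lia.
have [F FP] := choice (fun i => nested_towers (l0 i) (ratio i)).
pose mu i := l i k / 2 ^+ k.
have mu0 i : 0 < mu i by rewrite divr_gt0// exprn_gt0.
have mF i a : (a <= k)%N -> measurable (F i a : set X).
  by move=> ak; have [/(_ a ak)[]] := FP i.
have lF i a : (a <= k)%N -> leb (F i a) = (2 ^+ a * mu i)%:E.
  by move=> ak; have [/(_ a ak)[]] := FP i.
have sF i a : (a < k)%N -> F i a `<=` F i a.+1.
  by move=> ak; have [_ /(_ a ak)] := FP i.
clearbody mu.
pose E : set (euclidean R m.+1) := box (fun i => F i 0%N).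
have mE : measurable (tuple_box (fun i => F i 0%N)).
  by apply: measurable_tuple_box => i; exact: mF.
have vE : volume E = (\prod_(i < m.+1) mu i)%:E.
  rewrite (_ : E = tuple_box (fun i => F i 0%N))// volume_borel//.
  rewrite borel_volume_box => [|i]; last exact: mF.
  by rewrite -prodEFin; apply: eq_bigr => i _; rewrite lF// expr0 mul1r.
have high a x : (forall i, (a i <= k)%N) -> (\sum_i a i = k)%N ->
    tuple_box (fun i => F i (a i)) x ->
    ((2 ^- (k + m.+1))%:E <= maximal_operator B (\1_E) x)%E.
  move=> ak suma Fx.
  have [|w [I [ibI BI wI]] wN] := sel (fun i => if insub i is Some i' then a i' else 0%N).
    by move=> i _; case: insubP => // i' _ _; exact: ak.
  have [e [L [_ sides]]] := interval_box_sides ibI.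
  have lI i : leb (I i) = (L i)%:E by have [] := sides i.
  have L0 i : 0 < L i by have [] := sides i.
  have ex i : exists c : R, c < tnth x i < c + L i /\
      ((2 ^- a i * (L i / 2))%:E <= leb (F i 0%N `&` `]c, (c + L i)%R[))%E.
    have [_ _ /(_ (a i) (tnth x i) (L i) (ak i) (Fx i)) H] := FP i.
    have := wN i; rewrite valK wI lI /= => wNi.
    have sc sg := scale_of_spectrum sg (L0 i) erefl wNi.
    apply: H; last by rewrite L0; have [] := sc 0.
    move=> a0; have [_] := sc (sigma i (a i).-1); apply.
    have := gap i (a i).-1 (ltn_ord i); rewrite prednK// => /(_ (ak i)); lia.
  have [c cP] := choice ex.
  have := @maximal_operator_box_ge R m.+1 B I c L (fun i => 2 ^- a i / 2)
    (fun i => F i 0%N) x rB ibI BI lI (fun i => mF i 0%N isT).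
  have -> : \prod_(i < m.+1) (2 ^- a i / 2) = 2 ^- (k + m.+1) :> R.
    rewrite big_split/= prodr_const card_ord -suma exprD invfM expr_sum prodfV.
    by rewrite exprVn.
  apply=> i.
  - by have [] := cP i.
  - by rewrite divr_ge0// invr_ge0 exprn_ge0.
  - by rewrite -mulrA [2^-1 * _]mulrC; have [] := cP i.
pose q := (k %/ m.+1)%N.
pose s (phi : {ffun 'I_m -> 'I_q.+1}) := (\sum_j phi j)%N.
have sk phi : (s phi <= k)%N.
  apply: (@leq_trans (\sum_(j < m) q)); first by apply: leq_sum => j _; rewrite -ltnS.
  rewrite sum_nat_const card_ord (leq_trans _ (leq_trunc_div k m.+1))// mulnC.
  by rewrite leq_mul2l leqnSn orbT.
have phik (phi : {ffun 'I_m -> 'I_q.+1}) j : (phi j <= k)%N.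
  by apply: leq_trans (leq_div k m.+1); rewrite -ltnS.
pose D (phi : {ffun 'I_m -> 'I_q.+1}) (i : 'I_m.+1) : set R :=
  if unlift ord0 i is Some j then annulus (F i) (phi j) else F i (k - s phi)%N.
have mD phi i : measurable (D phi i : set X).
  rewrite /D; case: unliftP => [j ->|->]; last by apply: mF; exact: leq_subr.
  by apply: (measurable_annulus (mF _)); exact: phik.
have mDb phi : measurable (tuple_box (D phi)) by exact: measurable_tuple_box.
have Dhigh phi x : tuple_box (D phi) x ->
    ((2 ^- (k + m.+1))%:E <= maximal_operator B (\1_E) x)%E.
  pose a i := if unlift ord0 i is Some j then phi j : nat else (k - s phi)%N.
  move=> Dx; apply: (high a).
  - by move=> i; rewrite /a; case: unliftP => [j _|_]; [exact: phik|exact: leq_subr].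
  - rewrite big_ord_recl /a unlift_none (eq_bigr (fun j => phi j : nat)).
      by rewrite subnK.
    by move=> j _; rewrite liftK.
  - move=> i; have := Dx i; rewrite /D /a; case: unliftP => [j ->|->]//.
    exact: annulus_sub.
have tD : trivIset setT (fun phi => tuple_box (D phi)).
  apply/trivIsetP => phi psi _ _ neq; rewrite -subset0 => x [Dx Px].
  move/eqP: neq; apply; apply/ffunP => j; apply: val_inj => /=.
  have := Dx (lift ord0 j); have := Px (lift ord0 j); rewrite /D liftK => xp xd.
  exact: (annulus_disj (@sF _) (phik _ _) (phik _ _) xd xp).
have vD phi : ((2 ^+ k / 2 ^+ m * \prod_(i < m.+1) mu i)%:E <=
    borel_volume R m.+1 (tuple_box (D phi)))%E.
  rewrite borel_volume_box//.
  (* Each annulus keeps at least half the measure of its outer set, which costs the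
     factor [2 ^+ m]. *)
  pose d i := if unlift ord0 i is Some j then 2 ^+ phi j * mu i / 2
              else 2 ^+ (k - s phi) * mu i.
  have -> : 2 ^+ k / 2 ^+ m * \prod_(i < m.+1) mu i = \prod_(i < m.+1) d i.
    rewrite [in RHS]big_ord_recl /d unlift_none.
    rewrite (eq_bigr (fun j => 2 ^+ phi j * (mu (lift ord0 j) / 2))); last first.
      by move=> j _; rewrite liftK mulrA.
    rewrite big_split/= big_split/= prodr_const card_ord -expr_sum -/(s phi).
    rewrite [in LHS]big_ord_recl exprVn.
    have -> : 2 ^+ k = 2 ^+ (k - s phi) * 2 ^+ s phi :> R by rewrite -exprD subnK.
    ring.
  apply: prod_le_ereal => i; rewrite /d /D; case: unliftP => [j ->|->].
  - by rewrite divr_ge0// mulr_ge0 ?exprn_ge0// ltW.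
  - by rewrite mulr_ge0 ?exprn_ge0// ltW.
  - by apply: (annulus_measure (mF _) (lF _) (@sF _) (ltW (mu0 _))); exact: phik.
  - by rewrite lF// leq_subr.
have P0 : 0 < \prod_(i < m.+1) mu i by apply: prodr_gt0.
exists E; split.
- exact: borel_lebesgue.
- exists (\sum_i l i k) => x Ex i.
  have [/(_ 0%N isT)[_ /(_ _ (Ex i)) + _] _ _] := FP i.
  rewrite /= in_itv/= => /andP[x0 xl]; rewrite ger0_norm ?ltW//.
  apply: (lt_le_trans xl); rewrite (bigD1 i)//= lerDl sumr_ge0// => j _.
  exact: ltW.
- by rewrite vE lte_fin P0 ltry.
move=> alpha alphak.
pose U := \bigcup_(phi in [set: {ffun 'I_m -> 'I_q.+1}]) tuple_box (D phi).
have finT : finite_set [set: {ffun 'I_m -> 'I_q.+1}].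
  exact: finite_finset.
have mU : measurable U.
  by apply: fin_bigcup_measurable => [|phi _]; [exact: finT|exact: mDb].
apply: (@le_trans _ _ (volume U)); last first.
  apply: le_volume => x [phi _ Dx] /=; apply: lt_le_trans (Dhigh phi x Dx).
  by rewrite lte_fin.
rewrite vE volume_borel// /U measure_fin_bigcup//.
have sumT (G : {ffun 'I_m -> 'I_q.+1} -> \bar R) :
    (\sum_(phi \in [set: {ffun 'I_m -> 'I_q.+1}]) G phi = \sum_phi G phi)%E.
  rewrite [RHS]bigfs ?index_enum_uniq// => [|phi _]; last by rewrite mem_index_enum.
  by rewrite (_ : [set` predT] = [set: {ffun 'I_m -> 'I_q.+1}])//; apply/seteqP; split.
rewrite sumT.
apply: (@le_trans _ _ (\sum_(phi : {ffun 'I_m -> 'I_q.+1})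
    (2 ^+ k / 2 ^+ m * \prod_(i < m.+1) mu i)%:E)%E); last first.
  by apply: lee_sum => phi _; exact: vD.
rewrite sumEFin sumr_const card_ffun !card_ord -EFinM lee_fin.
by rewrite -[leRHS]mulr_natr natrX mulrAC.
Qed.

End lower_bound.

(** * Sharpness *)

Section sharp_lower_bound.
Context (R : realType).
Local Notation X := (measurableTypeR R).

(** For [alpha] bounded away from [0] the logarithmic factor is bounded, and an
    interval of the basis itself serves as [E]. *)
Lemma lower_bound_trivial n (B : set (set (euclidean R n))) : rare_basis B ->
  exists E : set (euclidean R n),
    [/\ measurable E, bounded_subset E, (0 < volume E < +oo)%E &
      forall alpha : R, alpha < 1 ->
        (volume E <= volume [set x | (alpha%:E < maximal_operator B (\1_E) x)%E])%E].
Proof.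
move=> rB; have [[A BA] Bbox _] := rB.
have [I ibI AI] := Bbox _ BA; subst A.
have [e [L [vI sides]]] := interval_box_sides ibI.
have mI : measurable (box I : set (euclidean R n)).
  apply: borel_lebesgue; apply: measurable_tuple_box => i.
  by apply: is_interval_measurable; exact: ibI.1.
have P0 : 0 < \prod_(i < n) L i by apply: prodr_gt0 => i _; have [] := sides i.
exists (box I); split => //.
- exists (\sum_i (`|e i| + L i)) => x Ix i.
  have [L0 _ /(_ _ (Ix i)) + _] := sides i.
  rewrite /= in_itv/= => /andP[ex xe].
  apply: (@le_trans _ _ (`|e i| + L i)).
    rewrite ler_norml; have := ler_norm (e i); have := ler_norm (- e i).
    by rewrite normrN => h1 h2; apply/andP; split; lra.
  rewrite [leRHS](bigD1 i)//= lerDl sumr_ge0// => j _.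
  by rewrite addr_ge0// ltW//; have [] := sides j.
- by rewrite vI lte_fin P0 ltry.
move=> alpha alpha1; apply: le_volume => x Ix /=.
apply: (lt_le_trans _ (ereal_sup_ubound _)); last by exists (box I); split.
rewrite (eq_integral (fun y => (\1_(box I) y)%:E)); last first.
  by move=> y _; rewrite ger0_norm// indicE ler0n.
by rewrite integral_indic// setIid vI [X in (_ * X)%E]vI /= -EFinM mulVf ?gt_eqF// lte_fin.
Qed.

Lemma dyadic_scale n (t : R) : 2 ^+ n < t ->
  exists k : nat, 2 ^+ (k + n) < t <= 2 ^+ (k + n).+1.
Proof.
move=> nt; have ex : exists j, t <= 2 ^+ (j + n).+1.
  exists (Num.truncn t); apply: (le_trans (ltW (truncnS_gt _))).
  rewrite -natrX ler_nat (leq_trans _ (ltnW (ltn_expl _ _)))//.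
  by rewrite ltnS leq_addr.
have [k tk kmin] := ex_minnP ex; exists k; rewrite tk andbT.
case: k kmin tk => [//|k] kmin _; rewrite ltNge; apply/negP => /kmin.
by rewrite ltnn.
Qed.

(** The constant: for small [alpha], [alpha^-1] lies between [2 ^ (k + n)] and
    [2 ^ (k + n + 1)], and
    [1 + log2 alpha^-1 <= k + n + 2 <= (n + 2) * n * (k / n + 1)]. *)
Lemma lower_bound m : exists2 c : R, 0 < c &
  forall B : set (set (euclidean R m.+1)), rare_basis B ->
    (exists2 S : 'I_m.+1 -> set int,
      forall i, infinite_set (S i) & dense_in (spectrum B) S) ->
    forall alpha : R, 0 < alpha < 1 ->
      exists E : set (euclidean R m.+1),
        [/\ measurable E, bounded_subset E, (0 < volume E < +oo)%E &
          ((c * alpha^-1 * (1 + log2 alpha^-1) ^+ m)%:E * volume E <=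
           volume [set x | (alpha%:E < maximal_operator B (\1_E) x)%E])%E].
Proof.
pose n := m.+1.
pose K : R := 2 ^+ n.+1 * 2 ^+ m * ((n.+2 * n)%:R) ^+ m.
have K0 : 0 < K by do 2?[apply: mulr_gt0]; rewrite exprn_gt0// ltr0n muln_gt0.
exists K^-1; first by rewrite invr_gt0.
move=> B rB dB alpha /andP[a0 a1].
set t := alpha^-1.
have t1 : 1 < t by rewrite invf_gt1.
have log0 : 0 <= log2 t by rewrite /log2 divr_ge0// ln_ge0// ?ler1n// ltW.
have l1 : 0 <= 1 + log2 t by rewrite addr_ge0.
have logle j : t <= 2 ^+ j -> log2 t <= j%:R.
  by move=> tj; rewrite -(log2_pow2 R j) ler_log2// (lt_trans ltr01).
have [tn|tn] := leP t (2 ^+ n).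
  have [E [mE bE vE H]] := lower_bound_trivial rB; exists E; split => //.
  apply: le_trans (H _ a1); rewrite -[leRHS]mul1e lee_wpmul2r//.
  rewrite lee_fin -mulrA ler_pdivrMl// mulr1 /K -mulrA.
  apply: ler_pM => //; first by rewrite ltW// (lt_trans ltr01).
  - by rewrite exprn_ge0// addr_ge0.
  - by rewrite (le_trans tn)// ler_weXn2l// ?ler1n.
  rewrite -exprMn lerXn2r ?nnegrE ?l1 ?mulr_ge0//.
  apply: (@le_trans _ _ (n.+1%:R)).
    by rewrite -[leRHS]nat1r lerD2l logle.
  by rewrite -natrM ler_nat /n; lia.
have [k /andP[kt tk]] := dyadic_scale tn.
have [E [mE bE vE H]] := lower_bound_dyadic k rB dB; exists E; split => //.
have /H : alpha < 2 ^- (k + m.+1).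
  by rewrite -[alpha]invrK ltf_pV2 ?posrE ?invr_gt0 ?exprn_gt0.
apply: le_trans; rewrite lee_wpmul2r// ?(ltW (andP vE).1)//.
rewrite lee_fin -mulrA ler_pdivrMl//.
have logk : 1 + log2 t <= (n.+2 * n)%:R * (k %/ n).+1%:R.
  apply: (@le_trans _ _ (k + n).+2%:R).
    by rewrite -[(k + n).+2%:R]nat1r lerD2l logle.
  rewrite -natrM ler_nat -mulnA.
  have nN : (n <= n * (k %/ n).+1)%N by rewrite leq_pmulr.
  have kN : (k < n * (k %/ n).+1)%N by rewrite mulnC ltn_ceil.
  have : (3 * (n * (k %/ n).+1) <= n.+2 * (n * (k %/ n).+1))%N.
    by rewrite leq_mul2r orbT.
  by lia.
have -> : K * (2 ^+ k / 2 ^+ m * (k %/ m.+1).+1%:R ^+ m) =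
    2 ^+ (k + n).+1 * ((n.+2 * n)%:R * (k %/ n).+1%:R) ^+ m.
  rewrite /K -addnS exprD exprMn; field; rewrite expf_neq0//.
apply: ler_pM => //; first by rewrite ltW// (lt_trans ltr01).
  by rewrite exprn_ge0// addr_ge0.
by rewrite lerXn2r ?nnegrE ?l1 ?mulr_ge0.
Qed.

(** Since [phi 0 = 0], the integral for the indicator of [E] at height [u^-1] is
    [phi u * volume E], and the finite volume of [E] cancels. *)
Lemma not_weak_type m (c : R) (B : set (set (euclidean R m.+1))) (phi : R -> R) :
  0 < c ->
  (forall alpha : R, 0 < alpha < 1 ->
      exists E : set (euclidean R m.+1),
        [/\ measurable E, bounded_subset E, (0 < volume E < +oo)%E &
          ((c * alpha^-1 * (1 + log2 alpha^-1) ^+ m)%:E * volume E <=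
           volume [set x | (alpha%:E < maximal_operator B (\1_E) x)%E])%E]) ->
  convex_increasing phi ->
  phi u / (u * (1 + log2 u) ^+ m) @[u --> +oo] --> (0 : R) ->
  ~ exists C : R, weak_type B phi C.
Proof.
move=> c0 lower [phi0 _ _ phiz] lim [C weak].
pose d := c / (`|C| + 1).
have C1 : 0 < `|C| + 1 by rewrite ltr_wpDl.
have d0 : 0 < d by rewrite divr_gt0.
move/cvgrPdist_lt : lim => /(_ d d0) [M [_ HM]].
pose u := Num.max M 1 + 1.
have Mu : M < u by rewrite /u ltr_pwDr// le_max lexx.
have u1 : 1 < u by rewrite /u ltr_pwDr// le_max lexx orbT.
have u0 : 0 < u by rewrite (lt_trans ltr01).
have log0 : 0 <= log2 u by rewrite /log2 divr_ge0// ln_ge0// ?ler1n// ltW.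
pose w := u * (1 + log2 u) ^+ m.
have w0 : 0 < w by rewrite mulr_gt0// exprn_gt0// ltr_pwDl.
have phiw : phi u < d * w.
  have := HM u Mu; rewrite /= sub0r normrN -/w => /(le_lt_trans (ler_norm _)).
  by rewrite ltr_pdivrMr.
have au : 0 < u^-1 < 1 by rewrite invr_gt0 u0 invf_lt1.
have [E [mE bE /andP[vE0 vEoo] low]] := lower _ au.
have mI : measurable_fun setT (\1_E : euclidean R m.+1 -> R) by exact: measurable_indic.
have := le_trans low (weak _ mI _ (andP au).1).
rewrite !invrK.
have phiI (x : euclidean R m.+1) :
    (phi (`|\1_E x| * u))%:E = ((phi u)%:E * (\1_E x)%:E)%E.
  rewrite indicE; case: (x \in E); last by rewrite normr0 mul0r phiz mule0.
  by rewrite normr1 mul1r mule1.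
under eq_integral do rewrite phiI.
have Evol : volume E = (fine (volume E))%:E.
  by rewrite fineK// ge0_fin_numE// ltW.
have mEI : measurable_fun setT (fun x : euclidean R m.+1 => (\1_E x)%:E : \bar R).
  by apply/measurable_EFinP.
have phiu0 : (0 <= (phi u)%:E)%E by rewrite lee_fin phi0// ltW.
rewrite (ge0_integralZl _ measurableT mEI _ phiu0); last first.
  by move=> x _; rewrite lee_fin indicE ler0n.
rewrite integral_indic// setIT.
have : 0 < fine (volume E) by rewrite -lte_fin -Evol.
rewrite Evol [X in (_ <= _ * (_ * X))%E]Evol -!EFinM lee_fin; set v := fine _ => v0.
rewrite mulrA ler_pM2r// -mulrA -/w leNgt => /negP; apply.
apply: (@le_lt_trans _ _ (`|C| * phi u)).
  by rewrite ler_wpM2r ?ler_norm// phi0// ltW.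
apply: (@le_lt_trans _ _ (`|C| * (d * w))).
  by rewrite ler_wpM2l// ltW.
have -> : c * w = (`|C| + 1) * (d * w) by rewrite /d; field; rewrite gt_eqF.
have dw0 : 0 < d * w by rewrite mulr_gt0.
by rewrite (ltr_pM2r dw0) ltrDl.
Qed.

End sharp_lower_bound.

Theorem theorem1 (R : realType) (n : nat) (n_gt0 : (0 < n)%N) :
  exists2 c : R, 0 < c &
    forall B : set (set (euclidean R n)), rare_basis B ->
      (exists2 S : 'I_n -> set int,
         forall i, infinite_set (S i) & dense_in (spectrum B) S) ->
      sharp_weak_type B /\
      forall alpha : R, 0 < alpha < 1 ->
        exists E : set (euclidean R n),
          [/\ measurable E, bounded_subset E, (0 < volume E)%E &
              (volume [set x | alpha%:E < maximal_operator B (\1_E) x] >=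
               (c * alpha^-1 * (1 + log2 alpha^-1) ^+ n.-1)%:E * volume E)%E].
Proof.
case: n n_gt0 => // m n_gt0; have [c c0 low] := lower_bound R m.
exists c => // B rB dB; have lowB := low B rB dB.
split; last first.
  move=> alpha /lowB[E [mE bE /andP[vE _] H]].
  by exists E; split.
split; first exact: rare_basis_weak_type.
by move=> phi cphi lim; exact: (not_weak_type c0 lowB cphi lim).
Qed.
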